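(* There is an algorithm that, given any $A\in\mathbb F^{n\times n}$ with $A^H=A$, computes an LDL factorization $P^TAP=LDL^H$ of $A$ and identifies the rank $r$ of $A$ using $$T_{\mathrm{LDL}}(n)=O(n^\omega)$$ arithmetic operations.
   Context: $\mathbb F$ is an arbitrary field with a fixed involution $a\mapsto a^*$ (a field automorphism with $(a^* )^*=a$, possibly the identity); $(X^H)_{ij}=x_{ji}^*$. The exponent $\omega>2$ is such that two $n\times n$ matrices over $\mathbb F$ can be multiplied in $O(n^\omega)$ arithmetic operations. Costs count arithmetic operations in $\mathbb F$; the algorithm may branch on whether computed elements are zero. An LDL factorization of a matrix $A\in\mathbb F^{n\times n}$ with $A^H=A$ is $P^TAP=LDL^H$, where $P$ is a permutation matrix, $L\in\mathbb F^{n\times n}$ is lower triangular with unit diagonal, and $D=D^H$ is block diagonal with each diagonal block either $1\times1$ or $2\times 2$ and anti-diagonal; the last $n-r$ rows and columns of $D$ are zero, where $r=\operatorname{rank}(A)$. *)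

(* Defs.v *)
From HB Require Import structures.
From mathcomp Require Import all_boot all_order all_fingroup all_algebra.
From mathcomp Require Import all_classical all_reals all_analysis.

Set Implicit Arguments.
Unset Strict Implicit.
Unset Printing Implicit Defensive.

Import Order.TTheory GRing.Theory Num.Theory.
Import numFieldNormedType.Exports.

Local Open Scope classical_set_scope.
Local Open Scope ring_scope.

(* An algorithm is a family of algebraic computation trees over F, one for each
   matrix size n (the usual non-uniform model of algebraic complexity).
   Operands are entries of the input (indexed by I), previously computed
   values (numbered from 0 in the order of computation), or constants.  The
   syntax is first order, so that a tree can obtain information about field
   elements only through [Branch], which tests an operand for being zero. *)
Inductive operand (F I : Type) : Type :=
  | Input of I
  | Computed of nat
  | Const of F.

Inductive operation (F I : Type) : Type :=
  | Add of operand F I & operand F I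
  | Sub of operand F I & operand F I
  | Mul of operand F I & operand F I
  | Div of operand F I & operand F I
  | Conj of operand F I.

Inductive ctree (F I X : Type) : Type :=
  | Output of X
  | Compute of operation F I & ctree F I X
  | Branch of operand F I & ctree F I X & ctree F I X.

Section Semantics.
Variables (F : fieldType) (conj : F -> F) (I X : Type) (env : I -> F).

(* A reference to a value that has not been computed reads as 0. *)
Definition read (s : seq F) (a : operand F I) : F :=
  match a with
  | Input i => env i
  | Computed k => s`_k
  | Const c => c
  end.

(* Division by 0 is a failure, unlike in the ambient library. *)
Definition perform (s : seq F) (o : operation F I) : option F :=
  match o with
  | Add a b => Some (read s a + read s b)
  | Sub a b => Some (read s a - read s b)
  | Mul a b => Some (read s a * read s b)
  | Div a b => if read s b == 0 then None else Some (read s a / read s b)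
  | Conj a => Some (conj (read s a))
  end.

(* [runs t s c s' x]: started with computed values [s], the tree [t] performs
   [c] operations and reaches the leaf [x] with computed values [s'].  Each
   operation, the involution included, costs 1; zero tests are free. *)
Fixpoint runs (t : ctree F I X) (s : seq F) (c : nat) (s' : seq F) (x : X)
    : Prop :=
  match t with
  | Output y => [/\ c = 0%N, s' = s & x = y]
  | Compute o u =>
      exists v c', [/\ perform s o = Some v, c = c'.+1 &
                       runs u (rcons s v) c' s' x]
  | Branch a u0 u1 => runs (if read s a == 0 then u0 else u1) s c s' x
  end.

End Semantics.

Definition entries (F : Type) (n : nat) (A : 'M[F]_n) (ij : 'I_n * 'I_n) : F :=
  A ij.1 ij.2.

Definition entries2 (F : Type) (n : nat) (X Y : 'M[F]_n)
    (k : ('I_n * 'I_n) + ('I_n * 'I_n)) : F :=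
  match k with inl ij => entries X ij | inr ij => entries Y ij end.

Definition big_O_pow (R : realType) (T : nat -> nat) (omega : R) : Prop :=
  (fun n : nat => (T n)%:R : R) =O_\oo (fun n : nat => n%:R `^ omega).

Definition matmul_exponent (F : fieldType) (conj : F -> F) (R : realType)
    (omega : R) : Prop :=
  exists (mm : forall n, ctree F (('I_n * 'I_n) + ('I_n * 'I_n))
                   'M[operand F (('I_n * 'I_n) + ('I_n * 'I_n))]_n)
         (T : nat -> nat),
    big_O_pow T omega /\
    forall (n : nat) (X Y : 'M[F]_n), exists c s Z,
      [/\ runs conj (entries2 X Y) (mm n) [::] c s Z,
          (c <= T n)%N &
          map_mx (read (entries2 X Y) s) Z = X *m Y].

Definition conj_trmx (F : fieldType) (conj : F -> F) (m n : nat)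
    (X : 'M[F]_(m, n)) : 'M[F]_(n, m) := (map_mx conj X)^T.

(* [sh] lists the sizes of the diagonal blocks, and [reshape_index sh i] is
   the number of the block that contains index i. *)
Definition block_diag_12 (F : fieldType) (n : nat) (D : 'M[F]_n) : Prop :=
  exists sh : seq nat,
    [/\ sumn sh = n,
        forall k, k \in sh -> k = 1%N \/ k = 2%N,
        forall i j : 'I_n,
          reshape_index sh i <> reshape_index sh j -> D i j = 0 &
        forall i : 'I_n, nth 0%N sh (reshape_index sh i) = 2%N -> D i i = 0].

Definition is_LDL (F : fieldType) (conj : F -> F) (n : nat)
    (A P L D : 'M[F]_n) : Prop :=
  [/\ is_perm_mx P,
      is_trig_mx L /\ (forall i, L i i = 1),
      conj_trmx conj D = D /\ block_diag_12 D,
      forall i j : 'I_n, (\rank A <= i)%N || (\rank A <= j)%N -> D i j = 0 &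
      P^T *m A *m P = L *m D *m conj_trmx conj L].

Record ldl_output (F : Type) (n : nat) : Type := LdlOutput {
  ldl_perm : 'S_n;
  ldl_L : 'M[operand F ('I_n * 'I_n)]_n;
  ldl_D : 'M[operand F ('I_n * 'I_n)]_n;
  ldl_rank : nat }.

(* T bounds the worst-case cost over all inputs A with A^H = A. *)
Definition ldl_algorithm (F : fieldType) (conj : F -> F)
    (alg : forall n, ctree F ('I_n * 'I_n) (ldl_output F n))
    (T : nat -> nat) : Prop :=
  forall (n : nat) (A : 'M[F]_n), conj_trmx conj A = A ->
    exists c s out,
      [/\ runs conj (entries A) (alg n) [::] c s out,
          (c <= T n)%N,
          is_LDL conj A (perm_mx (ldl_perm out))
            (map_mx (read (entries A) s) (ldl_L out))
            (map_mx (read (entries A) s) (ldl_D out)) &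
          ldl_rank out = \rank A].

(* Main.v *)
Require Import Defs.
From mathcomp Require Import all_boot all_order all_fingroup all_algebra.
From mathcomp Require Import all_classical all_reals all_analysis.
From mathcomp Require Import zify ring.

(* Everything stays in place: rows and columns keep their indices, and the pivots
   are recorded as lists of indices, so that all blocks have fixed sizes
   2^k x 2^k and every product costs O(2^(k omega)).

   A 2N x 2N matrix is factored as R = S D U, with D a partial permutation matrix
   up to scalars, by four recursive calls on N x N blocks; as omega > 2, the
   recurrence f(2N) = 4 f(N) + O(N^omega) gives O(N^omega).

   For a Hermitian A = [A11, A12; A12^H, A22], a recursive call factors A11.  What
   remains to be eliminated is [0, R; R^H, C].  A factorization of R gives pivots
   (p, c) in R, and each of them, taken with its mirror image, yields an
   anti-diagonal 2 x 2 block on the indices p and c, or, if the diagonal entry at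
   c does not vanish, two 1 x 1 blocks, with c before p.  A second recursive call
   handles the rest of the lower right block.  An A of arbitrary size is padded
   with zeros; zero rows never become pivots. *)

Set Implicit Arguments.
Unset Strict Implicit.
Unset Printing Implicit Defensive.

Import Order.TTheory GRing.Theory Num.Theory.

Local Open Scope ring_scope.

(** The pivots depend on the input while the block sizes must not. The elimination formulas are
    therefore written with the generalised inverse [mx_pinv] as if the blocks were invertible, and
    what they fail to clear stays in a residual. A residual vanishes on the rows or columns of the
    pivots already found, and a factorization neither places a pivot in a zero row nor alters that
    row ([factor_row0]); this is why pivots found in separate calls fit together.

    The order of c and p comes from the block [0, d; d^*, e] on p and c: to remove e while keeping d
    as a pivot, one would have to write e as x + x^*, which for the identity involution in
    characteristic 2 forces e = 0. If e is nonzero, it is itself taken as the first pivot, and the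
    Schur complement -d e^-1 d^* at p is the second. *)

(** * Pivot orders and monomial matrices *)

Section Before.
Variable T : eqType.
Implicit Types (s : seq T).

(** A non-member has index [size s], so it comes after all members, and two non-members are
    incomparable. *)
Definition before s (x y : T) := (index x s < index y s)%N.

Lemma before_trans s x y z : before s x y -> before s y z -> before s x z.
Proof. exact: ltn_trans. Qed.

Lemma before_irr s x : before s x x = false.
Proof. exact: ltnn. Qed.

Lemma before_asym s x y : before s x y -> before s y x = false.
Proof. by rewrite /before; case: ltngtP. Qed.

Lemma before_in s x y : before s x y -> x \in s.
Proof. by move=> /leq_trans /(_ (index_size _ _)); rewrite index_mem. Qed.

Lemma before_notin s x y : x \in s -> y \notin s -> before s x y.
Proof. by move=> xs ys; rewrite /before (memNindex ys) index_mem. Qed.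

Lemma before_total s x y :
  [|| before s x y, before s y x, x == y | (x \notin s) && (y \notin s)].
Proof.
rewrite /before; case: ltngtP => //= /eqP; case: (boolP (x \in s)) => xs.
  rewrite orbF => /eqP e; apply/eqP.
  have ys : y \in s by rewrite -index_mem -e index_mem.
  by rewrite -(nth_index x xs) e nth_index.
by rewrite (memNindex xs) eq_sym -[y \in s]index_mem => /eqP ->; rewrite ltnn orbT.
Qed.

Lemma before_catl s1 s2 x y : before s1 x y -> before (s1 ++ s2) x y.
Proof.
move=> b; rewrite /before !index_cat (before_in b); case: ifP => // _.
by rewrite ltn_addr // index_mem (before_in b).
Qed.

Lemma before_catr s1 s2 x y :
  y \notin s1 -> before s2 x y -> before (s1 ++ s2) x y.
Proof.
move=> ys b; rewrite /before !index_cat (negbTE ys); case: ifP => xs.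
  by rewrite ltn_addr // index_mem.
by rewrite ltn_add2l.
Qed.

Lemma before_cons s x y z :
  before (z :: s) x y = (y != z) && ((x == z) || before s x y).
Proof.
rewrite /before /= [z == x]eq_sym [z == y]eq_sym.
by case: (y == z); case: (x == z).
Qed.

End Before.

Lemma before_map (T U : eqType) (f : T -> U) s x y :
  injective f -> before (map f s) (f x) (f y) = before s x y.
Proof. by move=> finj; rewrite /before !index_map. Qed.

(** * Triangularity with respect to a pivot order *)

Section Unitriangular.
Variable F : fieldType.

(* Unit lower triangular in the order of the pivots [s], non-pivots coming
   last; moreover the columns of the non-pivots are those of the identity. *)
Definition unitri n (s : seq 'I_n) (S : 'M[F]_n) :=
  forall i j, ~~ before s j i -> S i j = (i == j)%:R.

Lemma unitri_diag n s (S : 'M[F]_n) i : unitri s S -> S i i = 1.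
Proof. by move=> /(_ i i); rewrite before_irr eqxx; exact. Qed.

Lemma unitri1 n (s : seq 'I_n) : unitri s 1%:M.
Proof. by move=> i j _; rewrite mxE. Qed.

Lemma unitri_mul n s (A B : 'M[F]_n) :
  unitri s A -> unitri s B -> unitri s (A *m B).
Proof.
move=> tA tB i j nji; rewrite mxE (bigD1 i) //= (unitri_diag _ tA) mul1r.
rewrite tB // big1 ?addr0 // => k ki.
case: (boolP (before s k i)) => bki; last by rewrite tA // eq_sym (negbTE ki) mul0r.
have njk : ~~ before s j k by apply: contra nji => bjk; exact: before_trans bki.
rewrite [B k j]tB //; case: eqP => [kj|_]; last by rewrite mulr0.
by move: nji; rewrite -kj bki.
Qed.

(** Off the diagonal, [S] is nonzero only in the columns of pivots, and there they meet zero rows of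
    [N]. *)
Lemma unitri_mul_id n p s (S : 'M[F]_n) (N : 'M[F]_(n, p)) :
  unitri s S -> (forall i j, i \in s -> N i j = 0) -> S *m N = N.
Proof.
move=> tS N0; apply/matrixP => i j; rewrite mxE (bigD1 i) //=.
rewrite (unitri_diag _ tS) mul1r big1 ?addr0 // => k ki.
case: (boolP (before s k i)) => [/before_in ks|b]; first by rewrite N0 ?mulr0.
by rewrite tS // eq_sym (negbTE ki) mul0r.
Qed.

Lemma unitri_block m n (s : seq 'I_(m + n)) (A : 'M[F]_m) (B : 'M[F]_(m, n))
    (C : 'M[F]_(n, m)) (D : 'M[F]_n) :
  (forall i j, ~~ before s (lshift n j) (lshift n i) -> A i j = (i == j)%:R) ->
  (forall i j, ~~ before s (rshift m j) (lshift n i) -> B i j = 0) ->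
  (forall i j, ~~ before s (lshift n j) (rshift m i) -> C i j = 0) ->
  (forall i j, ~~ before s (rshift m j) (rshift m i) -> D i j = (i == j)%:R) ->
  unitri s (block_mx A B C D).
Proof.
move=> hA hB hC hD i j; rewrite -[i]fintype.splitK -[j]fintype.splitK.
case: (fintype.split i) => {}i; case: (fintype.split j) => {}j /= b.
- by rewrite block_mxEul hA // (inj_eq (@lshift_inj _ _)).
- by rewrite block_mxEur hB // eq_lrshift.
- by rewrite block_mxEdl hC // eq_rlshift.
- by rewrite block_mxEdr hD // (inj_eq (@rshift_inj _ _)).
Qed.

(* With [0^-1 = 0], a generalised inverse of a matrix that has at most one
   nonzero entry in every row and column. *)
Definition mx_pinv m n (X : 'M[F]_(m, n)) : 'M[F]_(n, m) := (map_mx GRing.inv X)^T.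

Definition pivot_proj n (s : seq 'I_n) : 'M[F]_n := \matrix_(i, j) ((i == j) && (i \in s))%:R.

Lemma pivot_proj_mull n p s (M : 'M[F]_(n, p)) i j :
  (pivot_proj s *m M) i j = if i \in s then M i j else 0.
Proof.
rewrite mxE (bigD1 i) //= mxE eqxx /= big1 ?addr0 => [|k ki].
  by case: ifP; rewrite ?mul1r ?mul0r.
by rewrite mxE eq_sym (negbTE ki) mul0r.
Qed.

Lemma tr_pivot_proj n (s : seq 'I_n) : (pivot_proj s)^T = pivot_proj s.
Proof. by apply/matrixP => i j; rewrite !mxE eq_sym; case: (eqVneq i j) => [->|]. Qed.

Lemma pivot_proj_mulr n p s (M : 'M[F]_(p, n)) i j :
  (M *m pivot_proj s) i j = if j \in s then M i j else 0.
Proof.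
rewrite mxE (bigD1 j) //= mxE eqxx /= big1 ?addr0 => [|k kj].
  by case: ifP; rewrite ?mulr1 ?mulr0.
by rewrite mxE (negbTE kj) mulr0.
Qed.

Lemma mul0_supp m n p (M : 'M[F]_(m, n)) (N : 'M[F]_(n, p)) :
  (forall i j k, M i j = 0 \/ N j k = 0) -> M *m N = 0.
Proof.
move=> H; apply/matrixP => i k; rewrite !mxE big1 // => j _.
by case: (H i j k) => ->; rewrite ?mul0r ?mulr0.
Qed.

(** * Partial permutation matrices up to scalars *)

Definition monomial m n (pc : seq ('I_m * 'I_n)) (D : 'M[F]_(m, n)) :=
  [/\ uniq (unzip1 pc), uniq (unzip2 pc) &
      forall i j, (D i j != 0) = ((i, j) \in pc)].

Lemma unzip1P (T U : eqType) (pc : seq (T * U)) x :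
  reflect (exists y, (x, y) \in pc) (x \in unzip1 pc).
Proof.
apply: (iffP mapP) => [[[a b] ab ->]|[y xy]]; first by exists b.
by exists (x, y).
Qed.

Lemma unzip2P (T U : eqType) (pc : seq (T * U)) y :
  reflect (exists x, (x, y) \in pc) (y \in unzip2 pc).
Proof.
apply: (iffP mapP) => [[[a b] ab ->]|[x xy]]; first by exists a.
by exists (x, y).
Qed.

Lemma unzip1_uniqP (T U : eqType) (pc : seq (T * U)) x y y' :
  uniq (unzip1 pc) -> (x, y) \in pc -> (x, y') \in pc -> y = y'.
Proof.
elim: pc => [|[a b] l IH] //= /andP[al ul]; rewrite !inE => /orP[/eqP e|h] /orP[/eqP e'|h'].
- by case: e e' => -> -> [->].
- by case: e => e _; case/negP: al; apply/unzip1P; exists y'; rewrite -e.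
- by case: e' => e _; case/negP: al; apply/unzip1P; exists y; rewrite -e.
- exact: IH.
Qed.

Definition swap_pairs (T U : Type) (pc : seq (T * U)) := [seq (x.2, x.1) | x <- pc].

Lemma mem_swap_pairs (T U : eqType) (pc : seq (T * U)) x y :
  ((y, x) \in swap_pairs pc) = ((x, y) \in pc).
Proof.
apply/mapP/idP => [[[a b] ab [-> ->]] //|xy]; by exists (x, y).
Qed.

Lemma unzip1_swap (T U : Type) (pc : seq (T * U)) : unzip1 (swap_pairs pc) = unzip2 pc.
Proof. by rewrite /unzip1 -map_comp. Qed.

Lemma unzip2_swap (T U : Type) (pc : seq (T * U)) : unzip2 (swap_pairs pc) = unzip1 pc.
Proof. by rewrite /unzip2 -map_comp. Qed.

Lemma unzip2_uniqP (T U : eqType) (pc : seq (T * U)) x x' y :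
  uniq (unzip2 pc) -> (x, y) \in pc -> (x', y) \in pc -> x = x'.
Proof.
by rewrite -unzip1_swap -!(mem_swap_pairs pc); exact: unzip1_uniqP.
Qed.

Section Monomial.
Variables (m n : nat) (pc : seq ('I_m * 'I_n)) (D : 'M[F]_(m, n)).
Hypothesis mD : monomial pc D.

Lemma monomial_tr : monomial (swap_pairs pc) D^T.
Proof.
case: mD => u1 u2 h; split; rewrite ?unzip1_swap ?unzip2_swap // => i j.
by rewrite mem_swap_pairs mxE.
Qed.

Lemma monomial_row0 i j : i \notin unzip1 pc -> D i j = 0.
Proof.
case: mD => _ _ h ip; apply/eqP; apply: contraNT ip; rewrite h => ij.
by apply/unzip1P; exists j.
Qed.

Lemma monomial_mul p (M : 'M[F]_(n, p)) i c k :
  (i, c) \in pc -> (D *m M) i k = D i c * M c k.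
Proof.
move=> ic; case: mD => u1 u2 h; rewrite mxE (bigD1 c) //= big1 ?addr0 // => l lc.
have [->|] := eqVneq (D i l) 0; first by rewrite mul0r.
by rewrite h => il; rewrite (unzip1_uniqP u1 il ic) eqxx in lc.
Qed.

Lemma monomial_mul0 p (M : 'M[F]_(n, p)) i k :
  i \notin unzip1 pc -> (D *m M) i k = 0.
Proof. by move=> ip; rewrite mxE big1 // => l _; rewrite monomial_row0 ?mul0r. Qed.

Lemma mul_pinv : D *m mx_pinv D = pivot_proj (unzip1 pc).
Proof.
case: (mD) => u1 u2 h; apply/matrixP => i j; rewrite [RHS]mxE.
case: (boolP (i \in unzip1 pc)) => [/unzip1P[c ic]|ip]; last first.
  by rewrite andbF monomial_mul0.
rewrite (monomial_mul _ _ ic) !mxE andbT; case: eqP => [<-|ij].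
  by rewrite divff // h.
have [->|] := eqVneq (D j c) 0; first by rewrite invr0 mulr0.
by rewrite h => jc; case: ij; exact: unzip2_uniqP jc.
Qed.

Lemma pinv0 i j : (i, j) \notin pc -> mx_pinv D j i = 0.
Proof. by case: mD => _ _ h; rewrite -h negbK !mxE => /eqP ->; rewrite invr0. Qed.

End Monomial.

Lemma tr_pinv m n (D : 'M[F]_(m, n)) : (mx_pinv D)^T = mx_pinv D^T.
Proof. by apply/matrixP => i j; rewrite !mxE. Qed.

Section Monomial2.
Variables (m n : nat) (pc : seq ('I_m * 'I_n)) (D : 'M[F]_(m, n)).
Hypothesis mD : monomial pc D.

Lemma monomial_col0 i j : j \notin unzip2 pc -> D i j = 0.
Proof.
by rewrite -unzip1_swap => jp; have := monomial_row0 (monomial_tr mD) i jp; rewrite mxE.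
Qed.

Lemma pinv_mul : mx_pinv D *m D = pivot_proj (unzip2 pc).
Proof.
apply: trmx_inj; rewrite trmx_mul tr_pivot_proj tr_pinv (mul_pinv (monomial_tr mD)).
by rewrite unzip1_swap.
Qed.

Lemma mul_pivot_projl : pivot_proj (unzip1 pc) *m D = D.
Proof.
apply/matrixP => i j; rewrite pivot_proj_mull; case: ifP => // ip.
by rewrite (monomial_row0 mD) ?ip.
Qed.

Lemma pinv_mulK : mx_pinv D *m D *m mx_pinv D = mx_pinv D.
Proof.
rewrite pinv_mul; apply/matrixP => i j; rewrite pivot_proj_mull; case: ifP => // ip.
by rewrite !mxE monomial_col0 ?ip // invr0.
Qed.

Lemma pinv_row0 i j : i \notin unzip2 pc -> mx_pinv D i j = 0.
Proof. by move=> ip; rewrite !mxE monomial_col0 // invr0. Qed.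

Lemma pinv_col0 i j : j \notin unzip1 pc -> mx_pinv D i j = 0.
Proof. by move=> ip; rewrite !mxE (monomial_row0 mD) // invr0. Qed.

End Monomial2.

End Unitriangular.

(** * Composing computation trees *)

Section Programs.
Variables (F : fieldType) (conj : F -> F) (I : Type).
Local Notation op := (operand F I).

(* The argument is the number of values computed so far, which tells the
   program under which number its own next value will be stored. *)
Definition prog (X : Type) := nat -> ctree F I X.

Definition ret X (x : X) : prog X := fun _ => Output F I x.

Fixpoint bind_tree X Y (t : ctree F I X) (f : X -> prog Y) (n : nat) :
    ctree F I Y :=
  match t with
  | Output x => f x n
  | Compute o u => Compute o (bind_tree u f n.+1)
  | Branch a u v => Branch a (bind_tree u f n) (bind_tree v f n)
  end.

Definition bind X Y (p : prog X) (f : X -> prog Y) : prog Y :=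
  fun n => bind_tree (p n) f n.

Definition compute (o : operation F I) : prog op :=
  fun n => Compute o (Output F I (Computed F I n)).

Definition ifzero X (a : op) (p q : prog X) : prog X :=
  fun n => Branch a (p n) (q n).

Fixpoint foreach (T : eqType) Y (y0 : Y) (l : seq T) (p : T -> prog Y) :
    prog (T -> Y) :=
  if l is x :: l' then
    bind (p x) (fun y => bind (foreach y0 l' p)
      (fun g => ret (fun t => if t == x then y else g t)))
  else ret (fun _ => y0).

Definition matrix_prog m n (p : 'I_m -> 'I_n -> prog op) :
    prog 'M[op]_(m, n) :=
  bind (foreach (Const I 0) (enum {: 'I_m * 'I_n}) (fun ij => p ij.1 ij.2))
    (fun g => ret (\matrix_(i, j) g (i, j))).

Definition sub_prog m n (A B : 'M[op]_(m, n)) :=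
  matrix_prog (fun i j => compute (Defs.Sub (A i j) (B i j))).

Definition add_prog m n (A B : 'M[op]_(m, n)) :=
  matrix_prog (fun i j => compute (Add (A i j) (B i j))).

Definition conj_trmx_prog m n (A : 'M[op]_(m, n)) :=
  matrix_prog (fun i j => compute (Conj (A j i))).

(** The test comes first because [Div] by zero fails, whereas [mx_pinv] needs 0 there. *)
Definition pinv_prog m n (A : 'M[op]_(m, n)) :=
  matrix_prog (fun i j => ifzero (A j i) (ret (Const I 0))
    (compute (Div (Const I 1) (A j i)))).

(** Turns facts about field elements into booleans that later choices, such as the list of pivot
    blocks, may depend on: every outcome of the tests has its own branch. *)
Definition zeros_prog m n (A : 'M[op]_(m, n)) :=
  foreach false (enum {: 'I_m * 'I_n})
    (fun ij => ifzero (A ij.1 ij.2) (ret true) (ret false)).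

(** * Specifications with a cost bound *)

Section Spec.
Variable env : I -> F.
Implicit Types (s : seq F).

(** A Hoare triple with budget [b]. The final state extends [s], so that values computed earlier
    keep their numbers. *)
Definition does s X (p : prog X) (b : nat) (Q : seq F -> X -> Prop) : Prop :=
  exists c s' x, [/\ runs conj env (p (size s)) s c s' x, (c <= b)%N,
    prefix s s' & Q s' x].

Lemma does_ret s X (x : X) (Q : seq F -> X -> Prop) :
  Q s x -> does s (ret x) 0 Q.
Proof. by move=> Qx; exists 0%N, s, x; split=> //; exact: prefix_refl. Qed.

Lemma does_weaken s X (p : prog X) b b' (Q Q' : seq F -> X -> Prop) :
  does s p b Q -> (b <= b')%N -> (forall s' x, prefix s s' -> Q s' x -> Q' s' x) ->
  does s p b' Q'.
Proof.
move=> [c [s' [x [rp cb ss' Qx]]]] bb' QQ'; exists c, s', x.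
by split=> //; [exact: leq_trans bb' | exact: QQ'].
Qed.

Lemma runs_bind X Y (t : ctree F I X) (f : X -> prog Y) s c s' x c' s'' y :
  runs conj env t s c s' x -> runs conj env (f x (size s')) s' c' s'' y ->
  runs conj env (bind_tree t f (size s)) s (c + c') s'' y.
Proof.
elim: t s c => [z|o u IH|a u IHu v IHv] s c /=.
- by case=> -> -> ->.
- move=> [v [d [pv -> ru]]] rf; exists v, (d + c')%N; split => //.
  by rewrite -(size_rcons s v); exact: IH.
- by case: ifP => _; [exact: IHu | exact: IHv].
Qed.

Lemma does_bind s X Y (p : prog X) (f : X -> prog Y) b1 b2 Q1 Q2 :
  does s p b1 Q1 ->
  (forall s' x, prefix s s' -> Q1 s' x -> does s' (f x) b2 Q2) ->
  does s (bind p f) (b1 + b2) Q2.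
Proof.
move=> [c [s' [x [rp cb ss' Qx]]]] /(_ s' x ss' Qx).
move=> [d [s'' [y [rf db ss'' Qy]]]]; exists (c + d)%N, s'', y.
by split=> //; [exact: runs_bind rf | exact: leq_add | exact: prefix_trans ss''].
Qed.

Lemma does_ifzero s X a (p q : prog X) b Q :
  (read env s a = 0 -> does s p b Q) -> (read env s a != 0 -> does s q b Q) ->
  does s (ifzero a p q) b Q.
Proof.
rewrite /does /ifzero /=; case: eqP => [a0 /(_ a0)|_ _] //.
by apply.
Qed.

Lemma does_compute s o v :
  perform conj env s o = Some v ->
  does s (compute o) 1 (fun s' a => forall s'', prefix s' s'' -> read env s'' a = v).
Proof.
move=> ov; exists 1%N, (rcons s v), (Computed F I (size s)); split=> //.
- by exists v, 0%N.
- exact: prefix_rcons.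
move=> s'' /prefixP[t ->] /=.
by rewrite nth_cat size_rcons ltnS leqnn nth_rcons ltnn eqxx.
Qed.

Lemma does_foreach s (T : eqType) Y (y0 : Y) (l : seq T) (p : T -> prog Y) b Q :
  (forall s' s'' t y, prefix s' s'' -> Q s' t y -> Q s'' t y) ->
  (forall s' t, prefix s s' -> t \in l -> does s' (p t) b (fun s'' => Q s'' t)) ->
  does s (foreach y0 l p) (size l * b)
    (fun s' g => forall t, t \in l -> Q s' t (g t)).
Proof.
move=> Qmon; elim: l s => [|x l IH] s pl /=; first exact: does_ret.
rewrite mulSn; apply: does_bind.
  by apply: pl (prefix_refl s) _; rewrite mem_head.
move=> s1 y ss1 Qy; rewrite -[(size l * b)%N]addn0.
apply: does_bind.
  by apply: IH => s' t s1s' tl; apply: pl; rewrite ?inE ?tl ?orbT //; exact: prefix_trans s1s'.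
move=> s2 g s12 Qg; apply: does_ret => t.
by rewrite inE; case: eqP => [-> _|_ /Qg] //; exact: Qmon Qy.
Qed.

(* An operand may refer to a value that is not computed yet, hence the
   quantification over the extensions of the current state. *)
Definition denotes s m n (Z : 'M[op]_(m, n)) (X : 'M[F]_(m, n)) : Prop :=
  forall s', prefix s s' -> map_mx (read env s') Z = X.

Lemma denotes_mono s s' m n (Z : 'M[op]_(m, n)) X :
  prefix s s' -> denotes s Z X -> denotes s' Z X.
Proof. by move=> ss' dZ s'' s's''; apply: dZ; exact: prefix_trans s's''. Qed.

Lemma denotes_read s s' m n (Z : 'M[op]_(m, n)) (X : 'M[F]_(m, n)) i j :
  denotes s Z X -> prefix s s' -> read env s' (Z i j) = X i j.
Proof. by move=> dZ /dZ <-; rewrite mxE. Qed.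

Lemma denotesP s m n (Z : 'M[op]_(m, n)) (X : 'M[F]_(m, n)) :
  (forall s' i j, prefix s s' -> read env s' (Z i j) = X i j) -> denotes s Z X.
Proof. by move=> H s' ss'; apply/matrixP => i j; rewrite mxE; exact: H. Qed.

Lemma does_matrix_prog s m n (p : 'I_m -> 'I_n -> prog op) (X : 'M[F]_(m, n)) :
  (forall s' i j, prefix s s' -> does s' (p i j) 1 (fun s'' a =>
     forall s3, prefix s'' s3 -> read env s3 a = X i j)) ->
  does s (matrix_prog p) (m * n) (fun s' Z => denotes s' Z X).
Proof.
move=> pX; rewrite -[(m * n)%N]addn0.
have -> : (m * n = size (enum {: 'I_m * 'I_n}) * 1)%N.
  by rewrite muln1 -cardE card_prod !card_ord.
apply: does_bind.
  apply: (@does_foreach _ _ _ _ _ _ _ (fun s'' t a =>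
     forall s3, prefix s'' s3 -> read env s3 a = X t.1 t.2)).
    by move=> s1 s2 t y s12 H s3 s23; apply: H; exact: prefix_trans s23.
  by move=> s' t ss' _; exact: pX.
move=> s' g _ Qg; apply: does_ret; apply: denotesP => s'' i j s's''.
by rewrite mxE (Qg (i, j)) ?mem_enum.
Qed.

Lemma does_sub s m n (A B : 'M[op]_(m, n)) X Y :
  denotes s A X -> denotes s B Y ->
  does s (sub_prog A B) (m * n) (fun s' Z => denotes s' Z (X - Y)).
Proof.
move=> dA dB; apply: does_matrix_prog => s' i j ss'; apply: does_compute => /=.
by rewrite (denotes_read _ _ dA ss') (denotes_read _ _ dB ss') !mxE.
Qed.

Lemma does_add s m n (A B : 'M[op]_(m, n)) X Y :
  denotes s A X -> denotes s B Y ->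
  does s (add_prog A B) (m * n) (fun s' Z => denotes s' Z (X + Y)).
Proof.
move=> dA dB; apply: does_matrix_prog => s' i j ss'; apply: does_compute => /=.
by rewrite (denotes_read _ _ dA ss') (denotes_read _ _ dB ss') !mxE.
Qed.

Lemma does_conj_trmx s m n (A : 'M[op]_(m, n)) X :
  denotes s A X ->
  does s (conj_trmx_prog A) (n * m) (fun s' Z => denotes s' Z (conj_trmx conj X)).
Proof.
move=> dA; apply: does_matrix_prog => s' i j ss'; apply: does_compute => /=.
by rewrite (denotes_read _ _ dA ss') !mxE.
Qed.

Lemma does_pinv s m n (A : 'M[op]_(m, n)) X :
  denotes s A X ->
  does s (pinv_prog A) (n * m) (fun s' Z => denotes s' Z (mx_pinv X)).
Proof.
move=> dA; apply: does_matrix_prog => s' i j ss'.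
apply: does_ifzero; rewrite (denotes_read _ _ dA ss') => X0.
  apply: (@does_weaken _ _ _ 0 _ (fun s'' a => a = Const I 0)) => //.
    exact: does_ret.
  by move=> s'' x _ -> s3 _; rewrite !mxE X0 invr0.
apply: does_compute => /=.
by rewrite (denotes_read _ _ dA ss') (negbTE X0) !mxE mul1r.
Qed.

Lemma does_zeros s m n (A : 'M[op]_(m, n)) X :
  denotes s A X ->
  does s (zeros_prog A) 0 (fun s' z => forall i j, z (i, j) = (X i j == 0)).
Proof.
move=> dA; rewrite -(muln0 (size (enum {: 'I_m * 'I_n}))).
pose Q (_ : seq F) (t : 'I_m * 'I_n) z := z = (X t.1 t.2 == 0).
have H : does s (zeros_prog A) (size (enum {: 'I_m * 'I_n}) * 0)
    (fun s' g => forall t, t \in enum {: 'I_m * 'I_n} -> Q s' t (g t)).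
  apply: does_foreach => // s' [i j] ss' _ /=.
  apply: does_ifzero; rewrite (denotes_read _ _ dA ss') => X0; apply: does_ret.
    by rewrite /Q X0 eqxx.
  by rewrite /Q (negbTE X0).
apply: (does_weaken H) => // s' g _ H' i j.
by apply: (H' (i, j)); rewrite mem_enum.
Qed.

End Spec.

(** * Calling a tree as a subroutine *)

Section Relocate.
Variables (J : Type) (g : J -> op).

Definition relocate_operand (off : nat) (a : operand F J) : op :=
  match a with
  | Input j => g j
  | Computed k => Computed F I (off + k)
  | Const c => Const I c
  end.

Definition relocate_operation off (o : operation F J) : operation F I :=
  let r := relocate_operand off in
  match o with
  | Add a b => Add (r a) (r b)
  | Defs.Sub a b => Defs.Sub (r a) (r b)
  | Mul a b => Mul (r a) (r b)
  | Div a b => Div (r a) (r b)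
  | Conj a => Conj (r a)
  end.

(* A result that refers to a value never computed means 0 and must keep this
   meaning when the caller computes further values. *)
Definition relocate_result off cnt (a : operand F J) : op :=
  if a is Computed k then if (k < cnt)%N then Computed F I (off + k) else Const I 0
  else relocate_operand off a.

Fixpoint relocate_tree m n (t : ctree F J 'M[operand F J]_(m, n)) off cnt :
    ctree F I 'M[op]_(m, n) :=
  match t with
  | Output Z => Output F I (map_mx (relocate_result off cnt) Z)
  | Compute o u => Compute (relocate_operation off o) (relocate_tree u off cnt.+1)
  | Branch a u v => Branch (relocate_operand off a) (relocate_tree u off cnt)
                      (relocate_tree v off cnt)
  end.

Definition relocate m n (t : ctree F J 'M[operand F J]_(m, n)) :
  prog 'M[op]_(m, n) := fun off => relocate_tree t off 0.

Variables (env : I -> F) (envJ : J -> F) (s0 : seq F).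
Hypothesis envJP : forall j s, prefix s0 s -> read env s (g j) = envJ j.

Lemma read_relocate s a :
  read env (s0 ++ s) (relocate_operand (size s0) a) = read envJ s a.
Proof.
case: a => [j|k|c] //=; first by rewrite envJP ?prefix_prefix.
by rewrite nth_cat ltnNge leq_addr /= addKn.
Qed.

Lemma runs_relocate m n (t : ctree F J 'M[operand F J]_(m, n)) s c s' Z :
  runs conj envJ t s c s' Z ->
  runs conj env (relocate_tree t (size s0) (size s)) (s0 ++ s) c (s0 ++ s')
    (map_mx (relocate_result (size s0) (size s')) Z).
Proof.
elim: t s c => [W|o u IH|a u IHu v IHv] s c /=.
- by case=> -> -> ->.
- move=> [v [d [pv -> ru]]]; exists v, d; split=> //.
    by rewrite -pv; case: o {pv} => *; rewrite /= ?read_relocate.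
  by rewrite rcons_cat -(size_rcons s v); exact: IH.
- by rewrite read_relocate; case: ifP => _; [exact: IHu | exact: IHv].
Qed.

(** Makes the given multiplication trees, which read their arguments as inputs, applicable to
    matrices of intermediate results. *)
Lemma does_relocate m n (t : ctree F J 'M[operand F J]_(m, n)) c s Z b :
  runs conj envJ t [::] c s Z -> (c <= b)%N ->
  does env s0 (relocate t) b
    (fun s' Z' => denotes env s' Z' (map_mx (read envJ s) Z)).
Proof.
move=> rt cb; exists c, (s0 ++ s).
exists (map_mx (relocate_result (size s0) (size s)) Z); split=> //.
- by have := runs_relocate rt; rewrite cats0.
- exact: prefix_prefix.
apply: denotesP => s'' i j /prefixP[t' ->]; rewrite !mxE.
case: (Z i j) => [i0|k|d] //=.
  by rewrite envJP // -catA prefix_prefix.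
case: ltnP => ks /=.
  by rewrite -catA nth_cat ltnNge leq_addr /= addKn nth_cat ks.
by rewrite nth_default.
Qed.

End Relocate.

End Programs.

Arguments ret {F I X} x.

(** * Elimination of a square matrix *)

Section Pluq.
Variable F : fieldType.

Lemma unitri_mul_idr n p s (S : 'M[F]_n) (N : 'M[F]_(p, n)) :
  unitri s S^T -> (forall i j, j \in s -> N i j = 0) -> N *m S = N.
Proof.
move=> tS N0; apply: trmx_inj; rewrite trmx_mul (unitri_mul_id tS) // => i j js.
by rewrite mxE N0.
Qed.

(* Rows and columns are never permuted: the pivots sit at the positions [pc], in
   the order of this list, and [D] has nonzero entries exactly there. *)
Definition is_pluq n (R : 'M[F]_n) (pc : seq ('I_n * 'I_n)) (S S' D U U' : 'M[F]_n) :=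
  [/\ monomial pc D, unitri (unzip1 pc) S /\ unitri (unzip2 pc) U^T,
      S' *m S = 1%:M /\ U' *m U = 1%:M & R = S *m D *m U].

Lemma is_pluq_tr n (R : 'M[F]_n) pc S S' D U U' :
  is_pluq R pc S S' D U U' ->
  is_pluq R^T (swap_pairs pc) U^T U'^T D^T S^T S'^T.
Proof.
move=> [mD [tS tU] [S'S U'U] ->]; split; first exact: monomial_tr.
- by rewrite unzip1_swap unzip2_swap trmxK.
- by rewrite -!trmx_mul (mulmx1C U'U) (mulmx1C S'S) trmx1.
- by rewrite !trmx_mul mulmxA.
Qed.

(** Since [S *m D = R *m U'], multiplying by [mx_pinv D] shows that row i of [S] vanishes at all
    pivots. The unit diagonal then forbids i to be a pivot, and the other columns of [S] are those
    of the identity anyway. *)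
Lemma factor_row0 n (R : 'M[F]_n) pc (S D U U' : 'M[F]_n) i :
  monomial pc D -> unitri (unzip1 pc) S -> U' *m U = 1%:M -> R = S *m D *m U ->
  (forall j, R i j = 0) ->
  i \notin unzip1 pc /\ forall k, S i k = (i == k)%:R.
Proof.
move=> mD tS U'U eR Ri0.
have Sik k : k \in unzip1 pc -> S i k = 0.
  move=> kp; have : (S *m pivot_proj F (unzip1 pc)) i k = 0.
    rewrite -(mul_pinv mD) mulmxA.
    have -> : S *m D = R *m U' by rewrite eR -mulmxA (mulmx1C U'U) mulmx1.
    by rewrite -mulmxA mxE big1 // => j _; rewrite Ri0 mul0r.
  by rewrite pivot_proj_mulr kp.
have ip : i \notin unzip1 pc.
  apply/negP => /Sik; rewrite (unitri_diag _ tS); exact/eqP/oner_neq0.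
split=> // k; case: (boolP (k \in unzip1 pc)) => kp.
  by rewrite Sik //; case: eqP kp ip => // -> ->.
by apply: tS; apply: contra kp => /before_in.
Qed.

Lemma is_pluq_row0 n (R : 'M[F]_n) pc S S' D U U' i :
  is_pluq R pc S S' D U U' -> (forall j, R i j = 0) ->
  i \notin unzip1 pc /\ forall k, S i k = (i == k)%:R.
Proof. by move=> [mD [tS _] [_ U'U] eR]; exact: factor_row0 U'U eR. Qed.

Lemma is_pluq_col0 n (R : 'M[F]_n) pc S S' D U U' j :
  is_pluq R pc S S' D U U' -> (forall i, R i j = 0) ->
  j \notin unzip2 pc /\ forall k, U^T j k = (j == k)%:R.
Proof.
move=> /is_pluq_tr h R0; rewrite -unzip1_swap; apply: is_pluq_row0 h _ => i.
by rewrite mxE R0.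
Qed.

Definition map_pairs (A B A' B' : Type) (f : A -> A') (g : B -> B') (pc : seq (A * B)) :=
  [seq (f x.1, g x.2) | x <- pc].

Lemma mem_map_pairs (A B A' B' : eqType) (f : A -> A') (g : B -> B') pc a b :
  injective f -> injective g ->
  ((f a, g b) \in map_pairs f g pc) = ((a, b) \in pc).
Proof.
move=> fi gi; apply/mapP/idP => [[[x y] xy [/fi-> /gi->]] //|ab].
by exists (a, b).
Qed.

Lemma mem_map_pairs_out (A B A' B' : eqType) (f : A -> A') (g : B -> B') pc a b :
  (forall x, f x != a) \/ (forall y, g y != b) ->
  ((a, b) \in map_pairs f g pc) = false.
Proof.
move=> H; apply/mapP => -[[x y] _ [ea eb]].
by case: H => [/(_ x)|/(_ y)]; rewrite ?ea ?eb eqxx.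
Qed.

Lemma unzip1_map_pairs (A B A' B' : Type) (f : A -> A') (g : B -> B') pc :
  unzip1 (map_pairs f g pc) = map f (unzip1 pc).
Proof. by rewrite /unzip1 -!map_comp. Qed.

Lemma unzip2_map_pairs (A B A' B' : Type) (f : A -> A') (g : B -> B') pc :
  unzip2 (map_pairs f g pc) = map g (unzip2 pc).
Proof. by rewrite /unzip2 -!map_comp. Qed.

Lemma mem_lshift m n (s : seq 'I_m) i : (lshift n i \in map (@lshift m n) s) = (i \in s).
Proof. by rewrite mem_map //; exact: lshift_inj. Qed.

Lemma mem_rshift m n (s : seq 'I_n) i : (rshift m i \in map (@rshift m n) s) = (i \in s).
Proof. by rewrite mem_map //; exact: rshift_inj. Qed.

Lemma lshift_notin m n (s : seq 'I_n) i : (lshift n i \in map (@rshift m n) s) = false.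
Proof. by apply/mapP => -[j _ /eqP]; rewrite eq_lrshift. Qed.

Lemma rshift_notin m n (s : seq 'I_m) i : (rshift m i \in map (@lshift m n) s) = false.
Proof. by apply/mapP => -[j _ /eqP]; rewrite eq_rlshift. Qed.

Definition mem_shift := (mem_lshift, mem_rshift, lshift_notin, rshift_notin).

Lemma has_mem_disjoint (T : eqType) (s t : seq T) :
  (forall x, x \in s -> x \notin t) -> ~~ has (mem s) t.
Proof. by move=> H; apply/hasPn => x xt; apply/negP => /H; rewrite xt. Qed.

Section Block.
Variables (n : nat) (pc1 pc2 pc3 pc4 : seq ('I_n * 'I_n)).

(** The four lists are concatenated in the order of elimination, to which the triangularity of the
    factors refers. *)
Definition block_pairs : seq ('I_(n + n) * 'I_(n + n)) :=
  map_pairs (lshift n) (lshift n) pc1 ++ map_pairs (lshift n) (@rshift n n) pc2 ++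
  map_pairs (@rshift n n) (lshift n) pc3 ++ map_pairs (@rshift n n) (@rshift n n) pc4.

Lemma unzip1_block_pairs : unzip1 block_pairs =
  map (lshift n) (unzip1 pc1) ++ map (lshift n) (unzip1 pc2) ++
  map (@rshift n n) (unzip1 pc3) ++ map (@rshift n n) (unzip1 pc4).
Proof. by rewrite /unzip1 !map_cat -!/(unzip1 _) !unzip1_map_pairs. Qed.

Lemma unzip2_block_pairs : unzip2 block_pairs =
  map (lshift n) (unzip2 pc1) ++ map (@rshift n n) (unzip2 pc2) ++
  map (lshift n) (unzip2 pc3) ++ map (@rshift n n) (unzip2 pc4).
Proof. by rewrite /unzip2 !map_cat -!/(unzip2 _) !unzip2_map_pairs. Qed.

Lemma monomial_block (D1 D2 D3 D4 : 'M[F]_n) :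
  monomial pc1 D1 -> monomial pc2 D2 -> monomial pc3 D3 -> monomial pc4 D4 ->
  (forall x, x \in unzip1 pc1 -> x \notin unzip1 pc2) ->
  (forall x, x \in unzip1 pc3 -> x \notin unzip1 pc4) ->
  (forall x, x \in unzip2 pc1 -> x \notin unzip2 pc3) ->
  (forall x, x \in unzip2 pc2 -> x \notin unzip2 pc4) ->
  monomial block_pairs (block_mx D1 D2 D3 D4).
Proof.
move=> [u1 v1 h1] [u2 v2 h2] [u3 v3 h3] [u4 v4 h4] d12 d34 d13 d24.
have lI := @lshift_inj n n; have rI := @rshift_inj n n.
split.
- rewrite unzip1_block_pairs !cat_uniq !(map_inj_uniq lI) !(map_inj_uniq rI) u1 u2 u3 u4 !has_cat !negb_or /= !andbT.
  by repeat (apply/andP; split); apply: has_mem_disjoint => x /mapP[y ys ->]; rewrite ?mem_shift ?d12 ?d34.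
- rewrite unzip2_block_pairs !cat_uniq !(map_inj_uniq lI) !(map_inj_uniq rI) v1 v2 v3 v4 !has_cat !negb_or /= !andbT.
  by repeat (apply/andP; split); apply: has_mem_disjoint => x /mapP[y ys ->]; rewrite ?mem_shift ?d13 ?d24.
have lr i x : lshift n x != rshift n i by rewrite eq_lrshift.
have rl i x : rshift n x != lshift n i by rewrite eq_rlshift.
move=> i j; rewrite -[i]fintype.splitK -[j]fintype.splitK /block_pairs !mem_cat.
case: (fintype.split i) => {}i; case: (fintype.split j) => {}j /=.
- rewrite block_mxEul h1 mem_map_pairs // !mem_map_pairs_out ?orbF //; by [left|right].
- rewrite block_mxEur h2 (mem_map_pairs pc2) // !mem_map_pairs_out ?orbF //; by [left|right].
- rewrite block_mxEdl h3 (mem_map_pairs pc3) // !mem_map_pairs_out ?orbF //; by [left|right].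
- rewrite block_mxEdr h4 (mem_map_pairs pc4) // !mem_map_pairs_out ?orbF //; by [left|right].
Qed.

End Block.

Section Step.
Variables (n : nat) (R11 R12 R21 R22 : 'M[F]_n).
Variables (pc1 pc2 pc3 pc4 : seq ('I_n * 'I_n)).
Variables (S1 S1' D1 U1 U1' S2 S2' D2 U2 U2' : 'M[F]_n).
Variables (S3 S3' D3 U3 U3' S4 S4' D4 U4 U4' : 'M[F]_n).

Let B := S1' *m R12.
Let C := R21 *m U1'.
Let H := mx_pinv D1 *m B.
Let G := C *m mx_pinv D1.
(** The lower rows are transformed by [S3] and the right columns by [U2], so the Schur complement
    has to be expressed in these coordinates. *)
Let T := S3' *m (R22 - G *m B) *m U2'.
Let X := T *m mx_pinv D2.
Let T1 := T - X *m D2.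
Let Y := mx_pinv D3 *m T1.

Hypothesis h1 : is_pluq R11 pc1 S1 S1' D1 U1 U1'.
Hypothesis h2 : is_pluq (B - D1 *m H) pc2 S2 S2' D2 U2 U2'.
Hypothesis h3 : is_pluq (C - G *m D1) pc3 S3 S3' D3 U3 U3'.
Hypothesis h4 : is_pluq (T1 - D3 *m Y) pc4 S4 S4' D4 U4 U4'.

Let m1 : monomial pc1 D1. Proof. by case: h1. Qed.
Let m2 : monomial pc2 D2. Proof. by case: h2. Qed.
Let m3 : monomial pc3 D3. Proof. by case: h3. Qed.
Let m4 : monomial pc4 D4. Proof. by case: h4. Qed.

(** [D1 *m H] is the restriction of [B] to the pivot rows of [D1], so the residual is zero in these
    rows. *)
Let row12 i : i \in unzip1 pc1 -> i \notin unzip1 pc2 /\ forall k, S2 i k = (i == k)%:R.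
Proof.
move=> ip; apply: is_pluq_row0 h2 _ => j.
by rewrite /H mulmxA (mul_pinv m1) mxE [in X in _ + X]mxE pivot_proj_mull ip subrr.
Qed.

Let col13 i : i \in unzip2 pc1 -> i \notin unzip2 pc3 /\ forall k, U3^T i k = (i == k)%:R.
Proof.
move=> ip; apply: is_pluq_col0 h3 _ => j.
by rewrite /G -mulmxA (pinv_mul m1) mxE [in X in _ + X]mxE pivot_proj_mulr ip subrr.
Qed.

Let T1_col i j : j \in unzip2 pc2 -> T1 i j = 0.
Proof.
by move=> jp; rewrite /T1 /X -mulmxA (pinv_mul m2) mxE [in X in _ + X]mxE pivot_proj_mulr jp subrr.
Qed.

Let row34 i : i \in unzip1 pc3 -> i \notin unzip1 pc4 /\ forall k, S4 i k = (i == k)%:R.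
Proof.
move=> ip; apply: is_pluq_row0 h4 _ => j.
by rewrite /Y mulmxA (mul_pinv m3) mxE [in X in _ + X]mxE pivot_proj_mull ip subrr.
Qed.

(** [D3 *m Y] only selects rows of [T1], so subtracting it keeps the zero columns of [T1]. *)
Let col24 i : i \in unzip2 pc2 -> i \notin unzip2 pc4 /\ forall k, U4^T i k = (i == k)%:R.
Proof.
move=> ip; apply: is_pluq_col0 h4 _ => j.
rewrite /Y mulmxA (mul_pinv m3) mxE [in X in _ + X]mxE pivot_proj_mull T1_col //.
by rewrite if_same subrr.
Qed.

(* D1 clears the rest of its rows and columns (G, H), which leaves the residuals
   B - D1 H and C - G D1 to be factored; then D2 and D3 clear the last block
   (X, Y), and the rest of it is factored as S4 D4 U4. *)
Lemma pluq_step_eq :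
  block_mx R11 R12 R21 R22 =
  (block_mx S1 0 0 1%:M *m block_mx 1%:M 0 G 1%:M *m block_mx S2 0 0 S3 *m
   block_mx 1%:M 0 X 1%:M *m block_mx 1%:M 0 0 S4) *m
  block_mx D1 D2 D3 D4 *m
  (block_mx 1%:M 0 0 U4 *m block_mx 1%:M Y 0 1%:M *m block_mx U3 0 0 U2 *m
   block_mx 1%:M H 0 1%:M *m block_mx U1 0 0 1%:M).
Proof.
(* The product is evaluated from the middle outwards. [S4] fixes [D3] and [U4] fixes [D2], because
   the pivots of [D4] avoid the rows of the former and the columns of the latter. *)
have e3 : block_mx 1%:M 0 0 S4 *m block_mx D1 D2 D3 D4 *m block_mx 1%:M 0 0 U4 =
    block_mx D1 D2 D3 (T1 - D3 *m Y).
  rewrite !mulmx_block !(mul1mx, mulmx1, mul0mx, mulmx0, add0r, addr0).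
  case: h4 => _ [tS tU] _ <-; rewrite (unitri_mul_id tS); last first.
    by move=> i j; case: (boolP (i \in unzip1 pc3)) => [/row34[/negbTE-> //]|ip _];
       rewrite (monomial_row0 m3).
  rewrite (unitri_mul_idr tU) // => i j.
  by case: (boolP (j \in unzip2 pc2)) => [/col24[/negbTE-> //]|ip _];
     rewrite (monomial_col0 m2).
have e2 : block_mx 1%:M 0 X 1%:M *m block_mx D1 D2 D3 (T1 - D3 *m Y) *m
    block_mx 1%:M Y 0 1%:M = block_mx D1 D2 D3 T.
  rewrite !mulmx_block !(mul1mx, mulmx1, mul0mx, mulmx0, add0r, addr0).
  (* [D1] and [D2] have disjoint pivot rows, so clearing with [D2] does not disturb [D1]. *)
  have -> : X *m D1 = 0.
    rewrite /X -mulmxA (_ : mx_pinv D2 *m D1 = 0) ?mulmx0 //.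
    apply: mul0_supp => i j k; case: (boolP (j \in unzip1 pc1)) => [/row12[jp _]|jp].
      by left; rewrite (pinv_col0 m2).
    by right; rewrite (monomial_row0 m1).
  have -> : D1 *m Y = 0.
    rewrite /Y mulmxA (_ : D1 *m mx_pinv D3 = 0) ?mul0mx //.
    apply: mul0_supp => i j k; case: (boolP (j \in unzip2 pc1)) => [/col13[jp _]|jp].
      by right; rewrite (pinv_row0 m3).
    by left; rewrite (monomial_col0 m1).
  by rewrite !add0r addrCA [D3 *m Y + _]addrC subrK /T1 addrC subrK.
have e1 : block_mx S2 0 0 S3 *m block_mx D1 D2 D3 T *m block_mx U3 0 0 U2 =
    block_mx D1 (B - D1 *m H) (C - G *m D1) (R22 - G *m B).
  rewrite !mulmx_block !(mul1mx, mulmx1, mul0mx, mulmx0, add0r, addr0).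
  case: (h2) => _ [tS _] [_ U2U2] <-; case: (h3) => _ [_ tU] [S3S3 _] <-.
  rewrite (unitri_mul_id tS); last first.
    by move=> i j; case: (boolP (i \in unzip1 pc1)) => [/row12[/negbTE-> //]|ip _];
       rewrite (monomial_row0 m1).
  rewrite (unitri_mul_idr tU); last first.
    by move=> i j; case: (boolP (j \in unzip2 pc1)) => [/col13[/negbTE-> //]|ip _];
       rewrite (monomial_col0 m1).
  by rewrite /T !mulmxA (mulmx1C S3S3) mul1mx -[_ *m U2' *m U2]mulmxA U2U2 mulmx1.
have e0 : block_mx 1%:M 0 G 1%:M *m
    block_mx D1 (B - D1 *m H) (C - G *m D1) (R22 - G *m B) *m
    block_mx 1%:M H 0 1%:M = block_mx D1 B C R22.
  rewrite !mulmx_block !(mul1mx, mulmx1, mul0mx, mulmx0, add0r, addr0).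
  rewrite [G *m D1 + _]addrC addrNK [D1 *m H + _]addrC addrNK mulmxBr.
  have -> : G *m (D1 *m H) = C *m H.
    rewrite /G /H -(mulmxA C) (mulmxA D1). by rewrite [X in C *m X]mulmxA [X in C *m (X *m B)]mulmxA (pinv_mulK m1).
  by rewrite addrA [C *m H + _]addrC subrK [G *m B + _]addrC subrK.
rewrite !mulmxA.
rewrite -(mulmxA _ (block_mx 1%:M 0 0 S4)) -(mulmxA _ (_ *m block_mx D1 D2 D3 D4)) e3.
rewrite -(mulmxA _ (block_mx 1%:M 0 X 1%:M)) -(mulmxA _ (_ *m block_mx D1 D2 D3 _)) e2.
rewrite -(mulmxA _ (block_mx S2 0 0 S3)) -(mulmxA _ (_ *m block_mx D1 D2 D3 _)) e1.
rewrite -(mulmxA _ (block_mx 1%:M 0 G 1%:M)) -(mulmxA _ (_ *m block_mx D1 _ _ _)) e0.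
rewrite !mulmx_block !(mul1mx, mulmx1, mul0mx, mulmx0, add0r, addr0).
case: (h1) => _ _ [S1S1 U1U1] ->.
by rewrite /B /C mulmxA (mulmx1C S1S1) mul1mx -(mulmxA R21) U1U1 mulmx1.
Qed.

(** The nonzero columns of [G] and [X] are pivot rows of [D1] and [D2], which precede all lower
    rows. [S2] and [S4] are trivial in the rows of the earlier pivots of their half, so listing
    those first keeps them triangular. *)
Lemma pluq_step_rows :
  unitri (unzip1 (block_pairs pc1 pc2 pc3 pc4))
    (block_mx S1 0 0 1%:M *m block_mx 1%:M 0 G 1%:M *m block_mx S2 0 0 S3 *m
     block_mx 1%:M 0 X 1%:M *m block_mx 1%:M 0 0 S4).
Proof.
have [_ [t1 _] _ _] := h1; have [_ [t2 _] _ _] := h2.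
have [_ [t3 _] _ _] := h3; have [_ [t4 _] _ _] := h4.
have lI := @lshift_inj n n; have rI := @rshift_inj n n.
rewrite unzip1_block_pairs.
do 4?apply: unitri_mul; apply: unitri_block => i j b; try by rewrite mxE.
- apply: t1; apply: contra b => b.
  by apply: before_catl; rewrite before_map.
- rewrite /G mxE big1 // => k _; rewrite (pinv_col0 m1) ?mulr0 //.
  apply: contra b => b; apply: before_catl.
  by apply: before_notin; rewrite mem_shift.
- case: (boolP (i \in unzip1 pc1)) => [/row12[] //|ip]; apply: t2; apply: contra b => b.
  apply: before_catr; first by rewrite mem_shift.
  by apply: before_catl; rewrite before_map.
- apply: t3; apply: contra b => b.
  do 2![apply: before_catr; first by rewrite mem_shift].
  by apply: before_catl; rewrite before_map.
- rewrite /X mxE big1 // => k _; rewrite (pinv_col0 m2) ?mulr0 //.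
  apply: contra b => b; apply: before_catr; first by rewrite mem_shift.
  apply: before_catl; by apply: before_notin; rewrite mem_shift.
- case: (boolP (i \in unzip1 pc3)) => [/row34[] //|ip]; apply: t4; apply: contra b => b.
  do 3![apply: before_catr; first by rewrite mem_shift].
  by rewrite before_map.
Qed.

Lemma pluq_step_cols :
  unitri (unzip2 (block_pairs pc1 pc2 pc3 pc4))
    (block_mx 1%:M 0 0 U4 *m block_mx 1%:M Y 0 1%:M *m block_mx U3 0 0 U2 *m
     block_mx 1%:M H 0 1%:M *m block_mx U1 0 0 1%:M)^T.
Proof.
have [_ [_ t1] _ _] := h1; have [_ [_ t2] _ _] := h2.
have [_ [_ t3] _ _] := h3; have [_ [_ t4] _ _] := h4.
have lI := @lshift_inj n n; have rI := @rshift_inj n n.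
rewrite unzip2_block_pairs !trmx_mul !tr_block_mx !trmx0 !trmx1.
do 4?apply: unitri_mul; apply: unitri_block => i j b; try by rewrite mxE.
- apply: t1; apply: contra b => b.
  by apply: before_catl; rewrite before_map.
- rewrite mxE /H mxE big1 // => k _; rewrite (pinv_row0 m1) ?mul0r //.
  apply: contra b => b; apply: before_catl.
  by apply: before_notin; rewrite mem_shift.
- case: (boolP (i \in unzip2 pc1)) => [/col13[] //|ip]; apply: t3; apply: contra b => b.
  do 2![apply: before_catr; first by rewrite mem_shift].
  by apply: before_catl; rewrite before_map.
- apply: t2; apply: contra b => b.
  apply: before_catr; first by rewrite mem_shift.
  by apply: before_catl; rewrite before_map.
(* The right columns in [pc2] precede the left columns in [pc3], so [Y] must vanish there; it does
   because it is built from [T1], in which [D2] has already cleared these columns. *)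
- rewrite mxE /Y mxE; case: (boolP (i \in unzip2 pc2)) => ip.
    by rewrite big1 // => k _; rewrite T1_col ?mulr0.
  rewrite big1 // => k _; rewrite (pinv_row0 m3) ?mul0r //.
  apply: contra b => b; do 2![apply: before_catr; first by rewrite mem_shift].
  apply: before_catl; by apply: before_notin; rewrite mem_shift.
- case: (boolP (i \in unzip2 pc2)) => [/col24[] //|ip]; apply: t4; apply: contra b => b.
  do 3![apply: before_catr; first by rewrite mem_shift].
  by rewrite before_map.
Qed.

Lemma pluq_step (S' U' : 'M[F]_(n + n)) :
  let S := block_mx S1 0 0 1%:M *m block_mx 1%:M 0 G 1%:M *m block_mx S2 0 0 S3 *m
    block_mx 1%:M 0 X 1%:M *m block_mx 1%:M 0 0 S4 in
  let U := block_mx 1%:M 0 0 U4 *m block_mx 1%:M Y 0 1%:M *m block_mx U3 0 0 U2 *m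
    block_mx 1%:M H 0 1%:M *m block_mx U1 0 0 1%:M in
  S' *m S = 1%:M -> U' *m U = 1%:M ->
  is_pluq (block_mx R11 R12 R21 R22) (block_pairs pc1 pc2 pc3 pc4)
    S S' (block_mx D1 D2 D3 D4) U U'.
Proof.
move=> S U S'S U'U; split=> //.
- by apply: monomial_block => // x; [move/row12|move/row34|move/col13|move/col24] => -[].
- by split; [exact: pluq_step_rows | exact: pluq_step_cols].
- exact: pluq_step_eq.
Qed.

End Step.
Lemma is_pluq_11 (R : 'M[F]_1) :
  is_pluq R (if R 0 0 == 0 then [::] else [:: (0, 0)]) 1%:M 1%:M R 1%:M 1%:M.
Proof.
split; rewrite ?mul1mx ?mulmx1 ?trmx1 //; last by split; exact: unitri1.
by split; case: eqP => // R0 i j; rewrite !ord1 ?R0 ?eqxx //; exact/eqP.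
Qed.

End Pluq.

(** * Elimination of a Hermitian matrix *)

Section Ldl.
Variables (F : fieldType) (conj : {rmorphism F -> F}).
Hypothesis conjK : involutive conj.
Local Notation "X ^H" := (conj_trmx conj X) (at level 8, format "X ^H").

Lemma conj_trmxK m n (X : 'M[F]_(m, n)) : X^H^H = X.
Proof. by apply/matrixP => i j; rewrite !mxE conjK. Qed.

Lemma conj_trmx_mul m n p (X : 'M[F]_(m, n)) (Y : 'M[F]_(n, p)) :
  (X *m Y)^H = Y^H *m X^H.
Proof. by rewrite /conj_trmx map_mxM trmx_mul. Qed.

Lemma conj_trmxD m n (X Y : 'M[F]_(m, n)) : (X + Y)^H = X^H + Y^H.
Proof. by rewrite /conj_trmx map_mxD linearD. Qed.

Lemma conj_trmxN m n (X : 'M[F]_(m, n)) : (- X)^H = - X^H.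
Proof. by rewrite /conj_trmx map_mxN linearN. Qed.

Lemma conj_trmx0 m n : (0 : 'M[F]_(m, n))^H = 0.
Proof. by rewrite /conj_trmx map_mx0 trmx0. Qed.

Lemma conj_trmx1 n : (1%:M : 'M[F]_n)^H = 1%:M.
Proof. by rewrite /conj_trmx map_mx1 trmx1. Qed.

Lemma conj_trmx_block m n p q (A : 'M[F]_(m, n)) (B : 'M[F]_(m, p))
    (C : 'M[F]_(q, n)) (D : 'M[F]_(q, p)) :
  (block_mx A B C D)^H = block_mx A^H C^H B^H D^H.
Proof. by rewrite /conj_trmx map_block_mx tr_block_mx. Qed.

Lemma conj_trmx_pinv m n (X : 'M[F]_(m, n)) : (mx_pinv X)^H = mx_pinv X^H.
Proof. by apply/matrixP => i j; rewrite !mxE fmorphV. Qed.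

Definition conj_trmxE := (conj_trmx_mul, conj_trmxD, conj_trmxN, conj_trmxK,
  conj_trmx_pinv, conj_trmx1, conj_trmx0).

(* A block [:: a] carries the entry (a, a), and a block [:: a; b] the entries
   (a, b) and (b, a). *)
Definition block_entries (T : Type) (bl : seq (seq T)) : seq (T * T) :=
  flatten [seq zip b (rev b) | b <- bl].

Lemma block_entries_cat (T : Type) (bl1 bl2 : seq (seq T)) :
  block_entries (bl1 ++ bl2) = block_entries bl1 ++ block_entries bl2.
Proof. by rewrite /block_entries map_cat flatten_cat. Qed.

Lemma unzip1_block_entries (T : Type) (bl : seq (seq T)) :
  unzip1 (block_entries bl) = flatten bl.
Proof.
elim: bl => //= b bl IH; rewrite /block_entries /= /unzip1 map_cat.
by rewrite -/(unzip1 _) unzip1_zip ?size_rev // -/(unzip1 _) IH.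
Qed.

Lemma perm_unzip2_block_entries (T : eqType) (bl : seq (seq T)) :
  perm_eq (unzip2 (block_entries bl)) (flatten bl).
Proof.
elim: bl => //= b bl IH; rewrite /block_entries /= /unzip2 map_cat.
rewrite -/(unzip2 _) unzip2_zip ?size_rev // -/(unzip2 _).
by apply: perm_cat IH; rewrite perm_rev.
Qed.

Lemma block_entries_map (T U : Type) (f : T -> U) (bl : seq (seq T)) :
  block_entries (map (map f) bl) = map_pairs f f (block_entries bl).
Proof.
rewrite /map_pairs /block_entries map_flatten -!map_comp; congr flatten.
apply: eq_map => b /=; rewrite -map_rev.
by elim: b (rev b) => [|x b IH] [|y c] //=; rewrite IH.
Qed.

Definition is_ldl n (A : 'M[F]_n) (bl : seq (seq 'I_n)) (L K D : 'M[F]_n) :=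
  [/\ forall b, b \in bl -> size b = 1%N \/ size b = 2%N,
      unitri (flatten bl) L, K *m L = 1%:M, monomial (block_entries bl) D &
      A = L *m D *m L^H].

(** [D] is the congruence transform of [A] by [K]. *)
Lemma is_ldl_herm n (A : 'M[F]_n) bl L K D :
  A^H = A -> is_ldl A bl L K D -> D^H = D.
Proof.
move=> hA [_ _ KL _ eA].
have -> : D = K *m A *m K^H; last by rewrite !conj_trmxE hA mulmxA.
rewrite eA !mulmxA KL mul1mx -mulmxA -conj_trmx_mul.
by rewrite KL conj_trmx1 mulmx1.
Qed.

Lemma is_ldl_row0 n (A : 'M[F]_n) bl L K D i :
  is_ldl A bl L K D -> (forall j, A i j = 0) ->
  i \notin flatten bl /\ forall k, L i k = (i == k)%:R.
Proof.
move=> [_ tL KL mD eA]; rewrite -unzip1_block_entries.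
apply: (factor_row0 (U' := K^H) mD _ _ eA); first by rewrite unzip1_block_entries.
by rewrite -conj_trmx_mul (mulmx1C KL) conj_trmx1.
Qed.

Section PivotBlocks.
Variables (n : nat) (z : 'I_n -> bool).
Local Notation l := (lshift n).
Local Notation r := (@rshift n n).
Implicit Types (pc : seq ('I_n * 'I_n)).

(* If the diagonal entry at the column pivot c is nonzero, c and the row pivot
   p are eliminated one after the other, in this order. *)
Definition pivot_blocks pc : seq (seq 'I_(n + n)) :=
  flatten [seq (if z x.2 then [:: [:: l x.1; r x.2]]
                else [:: [:: r x.2]; [:: l x.1]]) | x <- pc].

Definition pivots pc := flatten (pivot_blocks pc).

Lemma pivots_cons p c pc : pivots ((p, c) :: pc) =
  (if z c then [:: l p; r c] else [:: r c; l p]) ++ pivots pc.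
Proof. by rewrite /pivots /pivot_blocks /=; case: (z c). Qed.

Lemma size_pivot_blocks pc b :
  b \in pivot_blocks pc -> size b = 1%N \/ size b = 2%N.
Proof.
case/flatten_mapP => -[p c] _ /=; case: (z c); rewrite !inE.
  by move/eqP->; right.
by case/orP => /eqP->; left.
Qed.

Lemma perm_pivots pc :
  perm_eq (pivots pc) (map l (unzip1 pc) ++ map r (unzip2 pc)).
Proof.
elim: pc => // -[p c] pc IH; rewrite pivots_cons /= -/(unzip1 pc) -/(unzip2 pc).
apply/seq.permP => a; move/seq.permP: IH => /(_ a).
by rewrite !count_cat /= ?count_cat /= => ->; case: (z c) => /=; lia.
Qed.

Lemma mem_pivotsl pc i : (l i \in pivots pc) = (i \in unzip1 pc).
Proof. by rewrite (perm_mem (perm_pivots pc)) mem_cat !mem_shift orbF. Qed.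

Lemma mem_pivotsr pc i : (r i \in pivots pc) = (i \in unzip2 pc).
Proof. by rewrite (perm_mem (perm_pivots pc)) mem_cat !mem_shift. Qed.

Let ell (i j : 'I_n) : (l i == l j) = (i == j). Proof. exact: (inj_eq (@lshift_inj _ _)). Qed.
Let err (i j : 'I_n) : (r i == r j) = (i == j). Proof. exact: (inj_eq (@rshift_inj _ _)). Qed.
Let elr (i j : 'I_n) : (l i == r j) = false. Proof. by rewrite eq_lrshift. Qed.
Let erl (i j : 'I_n) : (r i == l j) = false. Proof. by rewrite eq_rlshift. Qed.
Let eE := (ell, err, elr, erl).

Lemma before_pivots_ll pc i j :
  before (unzip1 pc) i j -> before (pivots pc) (l i) (l j).
Proof.
elim: pc => [|[p c] pc IH] //; rewrite pivots_cons /= before_cons.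
case/andP => jp h; case: (z c); rewrite /= !before_cons !eE jp /=;
  by case/orP: h => [->|/IH ->]; rewrite ?orbT.
Qed.

Lemma before_pivots_rr pc i j :
  before (unzip2 pc) i j -> before (pivots pc) (r i) (r j).
Proof.
elim: pc => [|[p c] pc IH] //; rewrite pivots_cons /= before_cons.
case/andP => jp h; case: (z c); rewrite /= !before_cons !eE jp /=;
  by case/orP: h => [->|/IH ->]; rewrite ?orbT.
Qed.

(** The order that [X] requires: through the pivot (p, c) it adds multiples of row p to the rows q
    that come after c. *)
Lemma before_pivots_lr pc p c q : uniq (unzip2 pc) ->
  (p, c) \in pc -> before (unzip2 pc) c q -> before (pivots pc) (l p) (r q).
Proof.
elim: pc => [|[p' c'] pc IH] //=; rewrite pivots_cons before_cons.
case/andP => c'pc u; rewrite inE => pc_in /andP[qc' h].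
case: (eqVneq (p, c) (p', c')) pc_in h => [[-> ->]|ne] /= pc_in h.
  by case: (z c'); rewrite /= !before_cons !eE eqxx qc' /= ?orbT.
have cc' : c == c' = false.
  by apply/eqP => e; case/negP: c'pc; rewrite -e; apply/unzip2P; exists p.
rewrite cc' /= in h; have {}IH := IH u pc_in h.
by case: (z c'); rewrite /= !before_cons !eE IH qc' /= ?orbT.
Qed.

(** The order that [Z] requires: the diagonal pivot at c clears the entry (p, c). *)
Lemma before_pivots_rl pc p c : uniq (unzip1 pc) ->
  (p, c) \in pc -> ~~ z c -> before (pivots pc) (r c) (l p).
Proof.
elim: pc => [|[p' c'] pc IH] //=; rewrite pivots_cons.
case/andP => p'pc u; rewrite inE => pc_in zc.
case: (eqVneq (p, c) (p', c')) pc_in zc => [[-> ->]|ne] /= pc_in zc.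
  by rewrite (negbTE zc) /= !before_cons !eE eqxx.
have pp' : p == p' = false.
  by apply/eqP => e; case/negP: p'pc; rewrite -e; apply/unzip1P; exists c.
have {}IH := IH u pc_in zc.
by case: (z c'); rewrite /= !before_cons !eE IH pp' /= ?orbT.
Qed.

Lemma mem_pivot_entries pc x y :
  reflect (exists p c, (p, c) \in pc /\
      (x, y) \in if z c then [:: (l p, r c); (r c, l p)]
                else [:: (r c, r c); (l p, l p)])
    ((x, y) \in block_entries (pivot_blocks pc)).
Proof.
have E p c pc' : block_entries (pivot_blocks ((p, c) :: pc')) =
  (if z c then [:: (l p, r c); (r c, l p)] else [:: (r c, r c); (l p, l p)])
   ++ block_entries (pivot_blocks pc').
  by rewrite /pivot_blocks /= block_entries_cat; case: (z c).
elim: pc => [|[p c] pc IH]; first by apply: (iffP idP) => // -[? [? []]].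
rewrite E mem_cat; apply: (iffP orP).
- case=> [h|/IH[p' [c' [h1 h2]]]]; first by exists p, c; rewrite mem_head.
  by exists p', c'; rewrite inE h1 orbT.
- move=> [p' [c' []]]; rewrite inE => /orP[/eqP[-> ->]|h1 h2]; first by left.
  by right; apply/IH; exists p', c'.
Qed.

End PivotBlocks.

Section Step.
Variables (n : nat) (A11 A12 A22 : 'M[F]_n) (bl1 bl3 : seq (seq 'I_n)).
Variables (L1 K1 D1 S S' Dl U U' L3 K3 D3 : 'M[F]_n) (pc : seq ('I_n * 'I_n)).
Hypotheses (hA11 : A11^H = A11) (hA22 : A22^H = A22).

Definition mask_mx m p (b : 'I_m -> 'I_p -> bool) (X : 'M[F]_(m, p)) : 'M[F]_(m, p) :=
  \matrix_(i, j) if b i j then X i j else 0.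

Let cs := unzip2 pc.
Variables (B H G W Y E W' X Z : 'M[F]_n).
Hypotheses (eB : B = K1 *m A12) (eH : H = mx_pinv D1 *m B)
  (eG : G = B^H *m mx_pinv D1) (eW : W = U'^H *m (A22 - G *m B) *m U')
  (eY : Y = mask_mx (fun i j => before cs j i) W)
  (eE : E = mask_mx (fun i j => (i == j) && (i \in cs)) W)
  (eW' : W' = mask_mx (fun i j => (i \notin cs) && (j \notin cs)) W)
  (eX : X = Y *m mx_pinv Dl) (eZ : Z = Dl *m mx_pinv E).

Hypothesis h1 : is_ldl A11 bl1 L1 K1 D1.
Hypothesis h2 : is_pluq (B - D1 *m H) pc S S' Dl U U'.
Hypothesis h3 : is_ldl W' bl3 L3 K3 D3.

Let m1 : monomial (block_entries bl1) D1. Proof. by case: h1. Qed.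
Let m2 : monomial pc Dl. Proof. by case: h2. Qed.
Let m3 : monomial (block_entries bl3) D3. Proof. by case: h3. Qed.

Let hD1 : D1^H = D1. Proof. exact: is_ldl_herm h1. Qed.

Let hW : W^H = W.
Proof. by rewrite eW eG !conj_trmxE hA22 hD1 !mulmxA. Qed.

Let mE : monomial [seq (c, c) | c <- cs & E c c != 0] E.
Proof.
case: m2 => _ u2 _.
have e1 : unzip1 [seq (c, c) | c <- cs & E c c != 0] = [seq c <- cs | E c c != 0].
  by rewrite /unzip1 -map_comp map_id.
have e2 : unzip2 [seq (c, c) | c <- cs & E c c != 0] = [seq c <- cs | E c c != 0].
  by rewrite /unzip2 -map_comp map_id.
split; rewrite ?e1 ?e2 ?filter_uniq // => i j.
apply/idP/mapP => [nz|[c]]; last by rewrite mem_filter => /andP[? _] [-> ->].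
have /andP[/eqP e ics] : (i == j) && (i \in cs).
  by apply: contraNT nz => /negbTE b; rewrite eE mxE b.
by exists i; rewrite -?e // mem_filter ics andbT {2}e.
Qed.

Let hE : E^H = E.
Proof.
rewrite eE; apply/matrixP => i j; rewrite !mxE [j == i]eq_sym.
case: (eqVneq i j) => [->|]; rewrite /= ?rmorph0 //.
by case: ifP; rewrite ?rmorph0 // -[in RHS]hW !mxE.
Qed.

Lemma ldl_step_herm : W'^H = W'.
Proof.
rewrite eW'; apply/matrixP => i j; rewrite !mxE andbC.
by case: ifP; rewrite ?rmorph0 // -[in RHS]hW !mxE.
Qed.

Let hD3 : D3^H = D3. Proof. exact: is_ldl_herm ldl_step_herm h3. Qed.

Let row12 i : i \in flatten bl1 -> i \notin unzip1 pc /\ forall k, S i k = (i == k)%:R.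
Proof.
move=> ip; apply: is_pluq_row0 h2 _ => j.
by rewrite eH mulmxA (mul_pinv m1) mxE [in X in _ + X]mxE pivot_proj_mull
  unzip1_block_entries ip subrr.
Qed.

Let row23 i : i \in cs -> i \notin flatten bl3 /\ forall k, L3 i k = (i == k)%:R.
Proof. by move=> ip; apply: is_ldl_row0 h3 _ => j; rewrite eW' mxE ip. Qed.

(** These are the cases of [before_total]. As non-pivots come last, [Y] also contains the entries in
    a pivot column and a non-pivot row, so only pairs of non-pivots remain for [W']. *)
Let W_split : W = Y + Y^H + E + W'.
Proof.
case: m2 => _ u2 _; rewrite eY eE eW'; apply/matrixP => i j; rewrite !mxE -[in X in conj X]hW !mxE.
have := before_total cs i j; case: (boolP (before cs i j)) => [b _|nb].
  rewrite (before_asym b) add0r; have ics := before_in b.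
  have -> : i == j = false by apply/eqP => e; rewrite e before_irr in b.
  by rewrite ics /= !addr0 conjK.
case: (boolP (before cs j i)) => [b _|nb'].
  have jcs := before_in b.
  have -> : i == j = false by apply/eqP => e; rewrite e before_irr in b.
  by rewrite jcs /= andbF rmorph0 !addr0.
rewrite rmorph0 !add0r /=.
case: (boolP (i \in cs)) => ics /=; last first.
  rewrite andbF add0r => /orP[/eqP <-|->] //; by rewrite ics.
by rewrite orbF => /eqP <-; rewrite eqxx /= addr0.
Qed.

(** [mx_pinv Dl *m Dl] projects onto the pivot columns, and [Y] is zero in all others. *)
Let XDl : X *m Dl = Y.
Proof.
rewrite eX eY -mulmxA (pinv_mul m2); apply/matrixP => i j; rewrite pivot_proj_mulr.
case: ifP => // jcs; rewrite mxE; case: ifP => // /before_in; rewrite -/cs jcs //.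
Qed.

(* In the coordinates given by L1, S and U^H the matrix is [D1, Dl; Dl^H, W].
   The part Y of W below the diagonal is cleared by Dl, and with it its conjugate
   transpose.  The diagonal part E at the pivot columns cannot always be cleared
   (in characteristic 2); where it is nonzero it serves as a 1 x 1 pivot, and Z
   clears the corresponding entries of Dl. *)
Lemma ldl_step_eq :
  block_mx A11 A12 A12^H A22 =
  let L := block_mx L1 0 0 1%:M *m block_mx 1%:M 0 G 1%:M *m block_mx S 0 0 U^H *m
    block_mx 1%:M 0 X 1%:M *m block_mx 1%:M 0 0 L3 *m block_mx 1%:M Z 0 1%:M in
  L *m block_mx (D1 - Z *m Dl^H) (Dl - Z *m E) (Dl - Z *m E)^H (E + D3) *m L^H.
Proof.
have simp := (mul1mx, mulmx1, mul0mx, mulmx0, add0r, addr0).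
have e5 : block_mx 1%:M Z 0 1%:M *m
    block_mx (D1 - Z *m Dl^H) (Dl - Z *m E) (Dl - Z *m E)^H (E + D3) *m
    (block_mx 1%:M Z 0 1%:M)^H = block_mx D1 Dl Dl^H (E + D3).
  rewrite conj_trmx_block !mulmx_block !conj_trmx1 !conj_trmx0 !simp.
  (* [E] lives on the pivot columns of [Dl], which [D3] avoids. *)
  have ZD3 : Z *m D3 = 0.
    rewrite eZ -mulmxA (_ : mx_pinv E *m D3 = 0) ?mulmx0 //.
    apply: mul0_supp => i j k; case: (boolP (j \in cs)) => jcs.
      right; have [jp _] := row23 jcs.
      by rewrite (monomial_row0 m3) // unzip1_block_entries.
    left; rewrite (pinv_col0 mE) //; apply: contra jcs => /unzip1P[d /mapP[c]].
    by rewrite mem_filter => /andP[_ ccs] [-> _].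
  have e12 : Dl - Z *m E + Z *m (E + D3) = Dl by rewrite mulmxDr ZD3 addr0 subrK.
  rewrite e12; congr block_mx; last first.
    by rewrite -[in RHS]e12 [RHS]conj_trmxD conj_trmx_mul [(E + D3)^H]conj_trmxD hD3 hE.
  (* The two corrections that [Z] makes to the upper left block cancel by the law
     [mx_pinv E *m E *m mx_pinv E = mx_pinv E]. *)
  have ZEZ : Z *m E *m Z^H = Dl *m Z^H.
    rewrite eZ !conj_trmxE hE -!mulmxA [mx_pinv E *m (E *m _)]mulmxA.
    by rewrite [_ *m (_ *m Dl^H)]mulmxA (pinv_mulK mE).
  by rewrite !conj_trmxE hE mulmxBr mulmxA ZEZ addrA addrNK subrK.
have e4 : block_mx 1%:M 0 0 L3 *m block_mx D1 Dl Dl^H (E + D3) *m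
    (block_mx 1%:M 0 0 L3)^H = block_mx D1 Dl Dl^H (E + W').
  rewrite conj_trmx_block !mulmx_block !conj_trmx1 !conj_trmx0 !simp.
  case: h3 => _ t3 _ _ eW3.
  (* [W'] is zero in the rows of [cs], so the pivots of [L3] lie outside [cs], where [N]
     vanishes. *)
  have L3id p (N : 'M[F]_(n, p)) : (forall i j, i \notin cs -> N i j = 0) -> L3 *m N = N.
    move=> N0; apply: unitri_mul_id t3 _ => i j ip; apply: N0.
    by apply/negP => /row23[/negP[]].
  have L3Dl : L3 *m Dl^H = Dl^H.
    by apply: L3id => i j ics; rewrite !mxE (monomial_col0 m2) // rmorph0.
  have L3E : L3 *m E = E.
    by apply: L3id => i j /negbTE ics; rewrite eE mxE ics andbF.
  have DlL3 : Dl *m L3^H = Dl by rewrite -[Dl]conj_trmxK -conj_trmx_mul L3Dl.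
  have EL3 : E *m L3^H = E by rewrite -{1}hE -conj_trmx_mul L3E hE.
  by rewrite L3Dl DlL3 mulmxDr mulmxDl L3E EL3 -eW3.
have e3 : block_mx 1%:M 0 X 1%:M *m block_mx D1 Dl Dl^H (E + W') *m
    (block_mx 1%:M 0 X 1%:M)^H = block_mx D1 Dl Dl^H W.
  rewrite conj_trmx_block !mulmx_block !conj_trmx1 !conj_trmx0 !simp.
  have XD1 : X *m D1 = 0.
    rewrite eX -mulmxA (_ : mx_pinv Dl *m D1 = 0) ?mulmx0 //.
    apply: mul0_supp => i j k; case: (boolP (j \in flatten bl1)) => [/row12[jp _]|jp].
      by left; rewrite (pinv_col0 m2).
    by right; rewrite (monomial_row0 m1) // unzip1_block_entries.
  have D1X : D1 *m X^H = 0 by rewrite -hD1 -conj_trmx_mul XD1 conj_trmx0.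
  rewrite XD1 D1X !add0r XDl; congr block_mx.
  by rewrite -conj_trmx_mul XDl [RHS]W_split -!addrA addrCA.
have e2 : block_mx S 0 0 U^H *m block_mx D1 Dl Dl^H W *m (block_mx S 0 0 U^H)^H =
    block_mx D1 (B - D1 *m H) (B - D1 *m H)^H (A22 - G *m B).
  rewrite conj_trmx_block !mulmx_block !conj_trmx0 !simp conj_trmxK.
  case: h2 => _ [tS _] [_ UU] eR.
  have SD1 : S *m D1 = D1.
    apply: unitri_mul_id tS _ => i j ip; rewrite (monomial_row0 m1) //.
    by rewrite unzip1_block_entries; apply/negP => /row12[/negP[]].
  have D1S : D1 *m S^H = D1 by rewrite -{1}hD1 -conj_trmx_mul SD1 hD1.
  rewrite SD1 D1S eR !conj_trmx_mul !mulmxA; congr block_mx.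
  rewrite eW !mulmxA -conj_trmx_mul UU conj_trmx1 mul1mx.
  by rewrite -[_ *m U' *m U]mulmxA UU mulmx1.
have e1 : block_mx 1%:M 0 G 1%:M *m
    block_mx D1 (B - D1 *m H) (B - D1 *m H)^H (A22 - G *m B) *m
    (block_mx 1%:M 0 G 1%:M)^H = block_mx D1 B B^H A22.
  rewrite conj_trmx_block !mulmx_block !conj_trmx1 !conj_trmx0 !simp.
  have GH : G^H = H by rewrite eG eH !conj_trmxE hD1.
  have GD1 : G *m D1 = (D1 *m H)^H by rewrite conj_trmx_mul -GH conj_trmxK hD1.
  rewrite GH addrC GD1 -conj_trmxD addrC [D1 *m H + _]addrC subrK.
  congr block_mx; rewrite mulmxBr.
  have -> : B^H *m H = G *m B by rewrite eG eH mulmxA.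
  have -> : G *m (D1 *m H) = G *m B.
    rewrite eG eH -(mulmxA B^H) [X in _ *m X]mulmxA [X in B^H *m X]mulmxA.
    by rewrite (pinv_mulK m1) mulmxA.
  by rewrite subrr add0r addrC subrK.
have e0 : block_mx L1 0 0 1%:M *m block_mx D1 B B^H A22 *m (block_mx L1 0 0 1%:M)^H =
    block_mx A11 A12 A12^H A22.
  rewrite conj_trmx_block !mulmx_block !conj_trmx1 !conj_trmx0 !simp.
  case: h1 => _ _ KL1 _ <-; rewrite -conj_trmx_mul eB mulmxA (mulmx1C KL1) mul1mx.
  by [].
by rewrite -e0 -e1 -e2 -e3 -e4 -e5 /= !conj_trmx_mul !mulmxA.
Qed.

Variable z : 'I_n -> bool.
Hypothesis hz : forall c, c \in cs -> z c = (E c c == 0).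

Definition ldl_blocks : seq (seq 'I_(n + n)) :=
  map (map (lshift n)) bl1 ++ pivot_blocks z pc ++ map (map (@rshift n n)) bl3.

Let flatten_blocks : flatten ldl_blocks =
  map (lshift n) (flatten bl1) ++ pivots z pc ++ map (@rshift n n) (flatten bl3).
Proof. by rewrite /ldl_blocks !flatten_cat -!map_flatten. Qed.

Lemma ldl_step_unitri : unitri (flatten ldl_blocks)
  (block_mx L1 0 0 1%:M *m block_mx 1%:M 0 G 1%:M *m block_mx S 0 0 U^H *m
    block_mx 1%:M 0 X 1%:M *m block_mx 1%:M 0 0 L3 *m block_mx 1%:M Z 0 1%:M).
Proof.
have [_ t1 _ _ _] := h1; have [_ [tS tU] _ _] := h2; have [_ t3 _ _ _] := h3.
have lI := @lshift_inj n n; have rI := @rshift_inj n n.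
have [u1 u2 _] := m2.
rewrite flatten_blocks.
do 5?apply: unitri_mul; apply: unitri_block => i j b; try by rewrite mxE.
- apply: t1; apply: contra b => b.
  by apply: before_catl; rewrite before_map.
- rewrite eG mxE big1 // => k _; rewrite (pinv_col0 m1) ?mulr0 //.
  rewrite unzip1_block_entries; apply: contra b => b; apply: before_catl.
  by apply: before_notin; rewrite mem_shift.
- case: (boolP (i \in flatten bl1)) => [/row12[] //|ip]; apply: tS; apply: contra b => b.
  apply: before_catr; first by rewrite mem_shift.
  by apply: before_catl; exact: before_pivots_ll.
- rewrite mxE mxE (_ : U j i = (i == j)%:R) ?rmorph_nat //.
  have <- : U^T i j = U j i by rewrite mxE.
  apply: tU.
  apply: contra b => b; apply: before_catr; first by rewrite mem_shift.
  by apply: before_catl; exact: before_pivots_rr.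
(* A nonzero entry (i, j) of [X] needs a k with (j, k) in [pc] and k before i, because [Y] is
   strictly lower triangular in the order [cs]. *)
- case: (boolP (j \in unzip1 pc)) => [/unzip1P[c jc]|jp]; last first.
    by rewrite eX mxE big1 // => k _; rewrite (pinv_col0 m2) ?mulr0.
  rewrite eX mxE big1 // => k _; rewrite eY mxE; case: ifP => bki; last by rewrite mul0r.
  case: (boolP ((j, k) \in pc)) => jk; last by rewrite (pinv0 m2) ?mulr0.
  case/negP: b; apply: before_catr; first by rewrite mem_shift.
  by apply: before_catl; exact: before_pivots_lr jk bki.
- case: (boolP (i \in cs)) => [/row23[] //|ip]; apply: t3; apply: contra b => b.
  apply: before_catr; first by rewrite mem_shift.
  apply: before_catr; first by rewrite mem_pivotsr.
  by rewrite before_map.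
(* A nonzero entry (i, j) of [Z] is a pair of [pc] with [E j j] nonzero, and [pivot_blocks] lists
   the column index of such a pair first. *)
- case: (boolP (i \in unzip1 pc)) => [/unzip1P[c ic]|ip]; last first.
    by rewrite eZ (monomial_mul0 m2).
  rewrite eZ (monomial_mul m2 _ _ ic).
  have [Ejc|] := eqVneq (E j c) 0; first by rewrite !mxE Ejc invr0 mulr0.
  move=> nz; have /andP[/eqP jc jcs] : (j == c) && (j \in cs).
    by apply: contraNT nz => /negbTE b'; rewrite eE mxE b'.
  rewrite -jc in ic nz *; case/negP: b.
  have ip : i \in unzip1 pc by apply/unzip1P; exists j.
  apply: before_catr.
    by rewrite mem_shift; apply/negP => /row12[]; rewrite ip.
  by apply: before_catl; apply: before_pivots_rl => //; rewrite hz.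
Qed.

Lemma ldl_step_monomial : monomial (block_entries ldl_blocks)
  (block_mx (D1 - Z *m Dl^H) (Dl - Z *m E) (Dl - Z *m E)^H (E + D3)).
Proof.
have lI := @lshift_inj n n; have rI := @rshift_inj n n.
have [u1 u2 nzDl] := m2; have [v1 _ nz1] := m1; have [v3 _ nz3] := m3.
rewrite unzip1_block_entries in v1; rewrite unzip1_block_entries in v3.
have uniq_blocks : uniq (flatten ldl_blocks).
  rewrite flatten_blocks !cat_uniq !(map_inj_uniq lI) !(map_inj_uniq rI) v1 v3.
  have -> : uniq (pivots z pc).
    rewrite (perm_uniq (perm_pivots z pc)) cat_uniq (map_inj_uniq lI) (map_inj_uniq rI) u1 u2.
    by rewrite andbT; apply: has_mem_disjoint => x /mapP[y _ ->]; rewrite mem_shift.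
  rewrite has_cat negb_or /= !andbT; repeat (apply/andP; split).
  - apply: has_mem_disjoint => x /mapP[y /row12[yp _] ->].
    by rewrite mem_pivotsl.
  - by apply: has_mem_disjoint => x /mapP[y _ ->]; rewrite mem_shift.
  - apply/hasPn => x /mapP[y yp ->] /=; rewrite mem_pivotsr.
    by apply/negP => /row23[/negP[]].
split; rewrite ?unzip1_block_entries //.
  by rewrite (perm_uniq (perm_unzip2_block_entries _)).
have lr (i x : 'I_n) : lshift n x != rshift n i by rewrite eq_lrshift.
have rl (i x : 'I_n) : rshift n x != lshift n i by rewrite eq_rlshift.
have E0 i j : (E i j != 0) -> i = j /\ i \in cs.
  move=> nz; have /andP[/eqP ij ics] : (i == j) && (i \in cs); last by [].
  by apply: contraNT nz => /negbTE b'; rewrite eE mxE b'.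
(* Subtracting this from [Dl] leaves just the entries of the anti-diagonal blocks. *)
have ZE i j : (Z *m E) i j = if E j j == 0 then 0 else Dl i j.
  rewrite eZ -mulmxA (pinv_mul mE) pivot_proj_mulr.
  case: ifP => [/unzip2P[c /mapP[d]]|].
    by rewrite mem_filter => /andP[/negbTE nz _] [_ ->]; rewrite nz.
  case: eqP => // /eqP nz; have [_ jcs] := E0 _ _ nz.
  case/unzip2P; exists j; apply/mapP; exists j; rewrite ?mem_filter ?nz //.
have DlZE i j : ((Dl - Z *m E) i j != 0) = ((i, j) \in pc) && z j.
  rewrite mxE [X in _ + X]mxE ZE -nzDl; case: (boolP ((i, j) \in pc)) => ij.
    have jcs : j \in cs by apply/unzip2P; exists i.
    by rewrite hz //; case: ifP; rewrite ?subr0 ?andbT // subrr eqxx andbF.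
  move: ij; rewrite -nzDl negbK => /eqP ->; rewrite if_same subr0 eqxx //.
(* Each pair (p, c) whose diagonal entry e at c is nonzero contributes d e^-1 d^* at (p, p), with d
   the entry of [Dl]; up to sign this is the second 1 x 1 pivot. *)
have ZDl i j : ((Z *m Dl^H) i j != 0) = (i == j) && [exists c, ((i, c) \in pc) && ~~ z c].
  case: (boolP (i \in unzip1 pc)) => [/unzip1P[c ic]|ip]; last first.
    rewrite eZ -mulmxA (monomial_mul0 m2) // eqxx; apply/esym/negP.
    case/andP => _ /existsP[c /andP[ic _]]; case/negP: ip; apply/unzip1P; by exists c.
  have ccs : c \in cs by apply/unzip2P; exists i.
  have -> : [exists c, ((i, c) \in pc) && ~~ z c] = ~~ z c.
    apply/existsP/idP => [[d /andP[id]]|zc]; last by exists c; rewrite ic.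
    by rewrite (unzip1_uniqP u1 id ic).
  have -> : (Z *m Dl^H) i j = Dl i c * (E c c)^-1 * conj (Dl j c).
    rewrite eZ -mulmxA (monomial_mul m2 _ _ ic) -mulrA; congr (_ * _).
    rewrite mxE (bigD1 c) //= !mxE big1 ?addr0 // => k kc; rewrite !mxE.
    have [->|/E0[e _]] := eqVneq (E k c) 0; first by rewrite invr0 mul0r.
    by rewrite e eqxx in kc.
  rewrite !mulf_eq0 invr_eq0 fmorph_eq0 !negb_or (nzDl i c) ic -hz //= andbC (nzDl j c).
  congr (_ && _); apply/idP/eqP => [jc|<-] //; exact: unzip2_uniqP jc.
rewrite /ldl_blocks !block_entries_cat !block_entries_map.
move=> i j; rewrite -[i]fintype.splitK -[j]fintype.splitK !mem_cat.
case: (fintype.split i) => {}i; case: (fintype.split j) => {}j /=.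
- rewrite block_mxEul mem_map_pairs // [X in _ || (_ || X)]mem_map_pairs_out; last by left.
  rewrite orbF -nz1 mxE [X in _ + X]mxE.
  have -> : ((lshift n i, lshift n j) \in block_entries (pivot_blocks z pc)) =
      ((Z *m Dl^H) i j != 0).
    rewrite ZDl; apply/mem_pivot_entries/andP.
      move=> [p [c [pc_in]]]; case zc: (z c); rewrite !inE !xpair_eqE.
        by rewrite !(inj_eq lI) ?eq_lrshift ?eq_rlshift /= andbF.
      rewrite !eq_lrshift !(inj_eq lI) /= => /andP[/eqP -> /eqP ->].
      by split=> //; apply/existsP; exists c; rewrite pc_in zc.
    move=> [/eqP <- /existsP[c /andP[ic /negbTE zc]]]; exists i, c; split=> //.
    by rewrite zc !inE eqxx orbT.
  have [D0|D0] := eqVneq (D1 i j) 0; first by rewrite D0 sub0r oppr_eq0.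
  have ip : i \in flatten bl1.
    by rewrite -unzip1_block_entries; apply/unzip1P; exists j; rewrite -nz1.
  have [ip' _] := row12 ip.
  by rewrite eZ -mulmxA (monomial_mul0 m2) // subr0 D0.
- rewrite block_mxEur DlZE !mem_map_pairs_out ?orbF /=; try by [left|right].
  apply/andP/mem_pivot_entries => [[ij zj]|[p [c [pc_in]]]].
    by exists i, j; rewrite zj mem_head.
  case zc: (z c); rewrite !inE !xpair_eqE !(inj_eq lI) ?(inj_eq rI) ?eq_lrshift ?eq_rlshift /=.
    by rewrite orbF => /andP[/eqP -> /eqP ->].
  by rewrite ?andbF.
- rewrite block_mxEdl !mem_map_pairs_out ?orbF /=; try by [left|right].
  rewrite mxE mxE fmorph_eq0 DlZE.
  apply/andP/mem_pivot_entries => [[ij zj]|[p [c [pc_in]]]].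
    by exists j, i; rewrite zj !inE eqxx orbT.
  case zc: (z c); rewrite !inE !xpair_eqE ?(inj_eq lI) ?(inj_eq rI) ?eq_lrshift ?eq_rlshift /=.
    by case/andP => /eqP -> /eqP ->.
  by rewrite ?andbF.
- rewrite block_mxEdr [X in _ || (_ || X)]mem_map_pairs // mem_map_pairs_out; last by left.
  rewrite /= -nz3 mxE.
  have -> : ((rshift n i, rshift n j) \in block_entries (pivot_blocks z pc)) =
      (E i j != 0).
    apply/mem_pivot_entries/idP.
      move=> [p [c [pc_in]]]; case zc: (z c); rewrite !inE !xpair_eqE.
        by rewrite !(inj_eq rI) ?eq_lrshift ?eq_rlshift /= andbF.
      rewrite !eq_rlshift !(inj_eq rI) /= orbF => /andP[/eqP -> /eqP ->].
      by rewrite -hz ?zc //; apply/unzip2P; exists p.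
    move=> nz; have [ij /unzip2P[p pi]] := E0 _ _ nz; exists p, i; split=> //.
    rewrite -ij in nz *; rewrite hz ?(negbTE nz) ?mem_head //.
    by apply/unzip2P; exists p.
  have [->|/[dup] nz /E0[_ ics]] := eqVneq (E i j) 0; first by rewrite add0r.
  have [ip _] := row23 ics.
  by rewrite (monomial_row0 m3) ?unzip1_block_entries // addr0 nz.
Qed.

Lemma ldl_step K :
  let L := block_mx L1 0 0 1%:M *m block_mx 1%:M 0 G 1%:M *m block_mx S 0 0 U^H *m
    block_mx 1%:M 0 X 1%:M *m block_mx 1%:M 0 0 L3 *m block_mx 1%:M Z 0 1%:M in
  K *m L = 1%:M ->
  is_ldl (block_mx A11 A12 A12^H A22) ldl_blocks L K
    (block_mx (D1 - Z *m Dl^H) (Dl - Z *m E) (Dl - Z *m E)^H (E + D3)).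
Proof.
move=> L KL; split=> //.
- move=> b; rewrite !mem_cat => /or3P[/mapP[c cb ->]||/mapP[c cb ->]].
  + by rewrite size_map; case: h1 => + _ _ _ _; exact.
  + exact: size_pivot_blocks.
  + by rewrite size_map; case: h3 => + _ _ _ _; exact.
- exact: ldl_step_unitri.
- exact: ldl_step_monomial.
- exact: ldl_step_eq.
Qed.

End Step.

Lemma is_ldl_11 (A : 'M[F]_1) :
  is_ldl A (if A 0 0 == 0 then [::] else [:: [:: 0]]) 1%:M 1%:M A.
Proof.
split; rewrite ?conj_trmx1 ?mul1mx ?mulmx1 //.
- by move=> b; case: ifP => // _; rewrite inE => /eqP ->; left.
- exact: unitri1.
- by split; case: eqP => // A0 i j; rewrite !ord1 ?A0 ?eqxx //; exact/eqP.
Qed.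

End Ldl.

(** * Programs for one level of the recursion *)

Section Algorithms.
Variables (F : fieldType) (conj : {rmorphism F -> F}) (I : Type).
Hypothesis conjK : involutive conj.
Local Notation op := (operand F I).
Local Notation prog := (prog F I).
Local Notation denotes := (denotes (I := I)).
Local Notation does := (does conj).
Local Notation conj_trmx := (conj_trmx conj).
Local Notation "x <- p ; q" := (bind p (fun x => q))
  (at level 100, p at next level, q at level 200, right associativity).

Definition mul_spec n (b : nat) (mul : 'M[op]_n -> 'M[op]_n -> prog 'M[op]_n) :=
  forall env s A B X Y, denotes env s A X -> denotes env s B Y ->
  does env s (mul A B) b (fun s' Z => denotes env s' Z (X *m Y)).

Lemma does_le env s X (p : prog X) b b' Q :
  does env s p b Q -> (b <= b')%N -> does env s p b' Q.
Proof. by move=> h bb'; exact: does_weaken h bb' _. Qed.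

Lemma denotes_const env s m n (X : 'M[F]_(m, n)) : denotes env s (map_mx (Const I) X) X.
Proof. by apply: denotesP => s' i j _; rewrite mxE. Qed.

Lemma denotes_block env s m n p q (A : 'M[op]_(m, n)) (B : 'M[op]_(m, p))
    (C : 'M[op]_(q, n)) (D : 'M[op]_(q, p)) XA XB XC XD :
  denotes env s A XA -> denotes env s B XB -> denotes env s C XC ->
  denotes env s D XD -> denotes env s (block_mx A B C D) (block_mx XA XB XC XD).
Proof.
move=> dA dB dC dD s' ss'.
by rewrite map_block_mx (dA _ ss') (dB _ ss') (dC _ ss') (dD _ ss').
Qed.

Lemma denotes_submx env s n (A : 'M[op]_(n + n)) X :
  denotes env s A X -> [/\ denotes env s (ulsubmx A) (ulsubmx X),
    denotes env s (ursubmx A) (ursubmx X), denotes env s (dlsubmx A) (dlsubmx X) &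
    denotes env s (drsubmx A) (drsubmx X)].
Proof.
by move=> dA; split=> s' /dA <-;
  rewrite (map_ulsubmx, map_ursubmx, map_dlsubmx, map_drsubmx).
Qed.

Definition mask_op m n (b : 'I_m -> 'I_n -> bool) (A : 'M[op]_(m, n)) : 'M[op]_(m, n) :=
  \matrix_(i, j) if b i j then A i j else Const I 0.

Lemma denotes_mask env s m n b (A : 'M[op]_(m, n)) X :
  denotes env s A X -> denotes env s (mask_op b A) (mask_mx b X).
Proof.
move=> dA; apply: denotesP => s' i j ss'; rewrite !mxE; case: ifP => // _.
exact: denotes_read dA ss'.
Qed.

Local Notation inv_pair n := ('M[op]_n * 'M[op]_n)%type.
Local Notation cst X := (map_mx (Const I) X).

(* Triangular factors are computed together with their inverses, so that no
   algorithm for inversion is needed. *)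
Definition denotes_pair env s n (z : inv_pair n) (X X' : 'M[F]_n) :=
  [/\ denotes env s z.1 X, denotes env s z.2 X' & X' *m X = 1%:M].

Lemma denotes_pair_mono env s s' n (z : inv_pair n) X X' :
  prefix s s' -> denotes_pair env s z X X' -> denotes_pair env s' z X X'.
Proof. by move=> ss' [d1 d2 e]; split=> //; exact: denotes_mono ss' _. Qed.

Definition id_pair n : inv_pair n := (cst 1%:M, cst 1%:M).

Lemma denotes_id_pair env s n : denotes_pair env s (id_pair n) 1%:M 1%:M.
Proof. by split; rewrite ?mul1mx //; exact: denotes_const. Qed.

Definition diag_pair n (z w : inv_pair n) : inv_pair (n + n) :=
  (block_mx z.1 (cst 0) (cst 0) w.1, block_mx z.2 (cst 0) (cst 0) w.2).

Lemma denotes_diag_pair env s n (z w : inv_pair n) X X' Y Y' :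
  denotes_pair env s z X X' -> denotes_pair env s w Y Y' ->
  denotes_pair env s (diag_pair z w) (block_mx X 0 0 Y) (block_mx X' 0 0 Y').
Proof.
move=> [d1 d2 e] [d3 d4 e']; split; try by apply: denotes_block => //; exact: denotes_const.
by rewrite mulmx_block !(mulmx0, mul0mx, addr0, add0r) e e' -scalar_mx_block.
Qed.

Lemma denotes_pair_conj env s n (z w : 'M[op]_n) X X' :
  denotes env s z (conj_trmx X) -> denotes env s w (conj_trmx X') -> X' *m X = 1%:M ->
  denotes_pair env s (z, w) (conj_trmx X) (conj_trmx X').
Proof. by move=> dz dw e; split=> //; rewrite -conj_trmx_mul (mulmx1C e) conj_trmx1. Qed.

Definition lower_pair n (Z : 'M[op]_n) : prog (inv_pair (n + n)) :=
  Z' <- sub_prog (cst 0) Z;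
  ret (block_mx (cst 1%:M) (cst 0) Z (cst 1%:M), block_mx (cst 1%:M) (cst 0) Z' (cst 1%:M)).

Definition upper_pair n (Z : 'M[op]_n) : prog (inv_pair (n + n)) :=
  Z' <- sub_prog (cst 0) Z;
  ret (block_mx (cst 1%:M) Z (cst 0) (cst 1%:M), block_mx (cst 1%:M) Z' (cst 0) (cst 1%:M)).

Lemma does_lower_pair env s n (Z : 'M[op]_n) X :
  denotes env s Z X -> does env s (lower_pair Z) (n * n)
    (fun s' z => exists X', denotes_pair env s' z (block_mx 1%:M 0 X 1%:M) X').
Proof.
move=> dZ; rewrite -[(n * n)%N]addn0; apply: does_bind.
  by apply: does_sub dZ; exact: denotes_const.
move=> s' Z' ss' dZ'; apply: does_ret; exists (block_mx 1%:M 0 (0 - X) 1%:M).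
split; try by apply: denotes_block => //; try exact: denotes_const; exact: denotes_mono dZ.
rewrite mulmx_block !(mulmx0, mul0mx, mulmx1, mul1mx, addr0, add0r) addNr.
by rewrite -scalar_mx_block.
Qed.

Lemma does_upper_pair env s n (Z : 'M[op]_n) X :
  denotes env s Z X -> does env s (upper_pair Z) (n * n)
    (fun s' z => exists X', denotes_pair env s' z (block_mx 1%:M X 0 1%:M) X').
Proof.
move=> dZ; rewrite -[(n * n)%N]addn0; apply: does_bind.
  by apply: does_sub dZ; exact: denotes_const.
move=> s' Z' ss' dZ'; apply: does_ret; exists (block_mx 1%:M (0 - X) 0 1%:M).
split; try by apply: denotes_block => //; try exact: denotes_const; exact: denotes_mono dZ.
rewrite mulmx_block !(mulmx0, mul0mx, mulmx1, mul1mx, addr0, add0r) subrr.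
by rewrite -scalar_mx_block.
Qed.

Definition mul_pair n (mul : 'M[op]_n -> 'M[op]_n -> prog 'M[op]_n) (z w : inv_pair n) :
    prog (inv_pair n) :=
  A <- mul z.1 w.1; B <- mul w.2 z.2; ret (A, B).

Lemma does_mul_pair env s n b mul (z w : inv_pair n) X X' Y Y' :
  mul_spec b mul -> denotes_pair env s z X X' -> denotes_pair env s w Y Y' ->
  does env s (mul_pair mul z w) (b + b)
    (fun s' t => denotes_pair env s' t (X *m Y) (Y' *m X')).
Proof.
move=> hmul [d1 d2 e] [d3 d4 e']; apply: does_bind; first exact: hmul d1 d3.
move=> s1 A ss1 dA; rewrite -[b]addn0; apply: does_bind.
  by apply: hmul; [exact: denotes_mono ss1 d4 | exact: denotes_mono ss1 d2].
move=> s2 B s12 dB; apply: does_ret; split=> //; first exact: denotes_mono dA.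
by rewrite mulmxA -(mulmxA Y') e mulmx1.
Qed.

Record pluq_result n := PluqResult {
  pluq_pairs : seq ('I_n * 'I_n);
  pluq_lower : inv_pair n;
  pluq_mid : 'M[op]_n;
  pluq_upper : inv_pair n }.

Definition pluq_spec n b (p : 'M[op]_n -> prog (pluq_result n)) :=
  forall env s A R, denotes env s A R ->
  does env s (p A) b (fun s' o => exists S S' D U U',
    [/\ denotes_pair env s' (pluq_lower o) S S', denotes env s' (pluq_mid o) D,
        denotes_pair env s' (pluq_upper o) U U' &
        is_pluq R (pluq_pairs o) S S' D U U']).

Record ldl_result n := LdlResult {
  ldl_blks : seq (seq 'I_n);
  ldl_lower : inv_pair n;
  ldl_mid : 'M[op]_n }.

Definition ldl_spec n b (p : 'M[op]_n -> prog (ldl_result n)) :=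
  forall env s A R, denotes env s A R -> conj_trmx R = R ->
  does env s (p A) b (fun s' o => exists L K D,
    [/\ denotes_pair env s' (ldl_lower o) L K, denotes env s' (ldl_mid o) D &
        is_ldl conj R (ldl_blks o) L K D]).

Ltac advance :=
  let ss := fresh in move=> ss;
  match type of ss with is_true (prefix ?s ?s') =>
    repeat match goal with
    | d : denotes ?e s ?Z ?X |- _ => apply (denotes_mono ss) in d
    | d : denotes_pair ?e s ?z ?X ?X' |- _ => apply (denotes_pair_mono ss) in d
    end
  end; clear ss.

Tactic Notation "bind_step" constr(spec) :=
  apply: does_bind; [apply: spec; eassumption | let s := fresh "t" in
    let ss := fresh in let x := fresh in let d := fresh in
    move=> s x ss d; move: x d; move: ss; advance].

Ltac solve_pair :=
  first [eassumption | apply: denotes_id_pair |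
         apply: denotes_diag_pair; first [eassumption | apply: denotes_id_pair]].

Section Step.
Variables (n u f g : nat).
Variables (mul : 'M[op]_n -> 'M[op]_n -> prog 'M[op]_n)
  (mul2 : 'M[op]_(n + n) -> 'M[op]_(n + n) -> prog 'M[op]_(n + n))
  (pluq : 'M[op]_n -> prog (pluq_result n)) (ldl : 'M[op]_n -> prog (ldl_result n)).
Hypotheses (hmul : mul_spec u mul) (hmul2 : mul_spec u mul2)
  (hpluq : pluq_spec f pluq) (hldl : ldl_spec g ldl) (hu : (n * n <= u)%N).

Ltac pair_step :=
  apply: does_bind; [apply: (does_mul_pair hmul2); solve_pair |
    let s := fresh "t" in let ss := fresh in let x := fresh in let d := fresh in
    move=> s x ss d; move: x d; move: ss; advance].

Definition pluq_step_prog (A : 'M[op]_(n + n)) : prog (pluq_result (n + n)) :=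
  o1 <- pluq (ulsubmx A);
  B <- mul (pluq_lower o1).2 (ursubmx A);
  C <- mul (dlsubmx A) (pluq_upper o1).2;
  P1 <- pinv_prog (pluq_mid o1);
  H <- mul P1 B;
  G <- mul C P1;
  DH <- mul (pluq_mid o1) H;
  R12 <- sub_prog B DH;
  GD <- mul G (pluq_mid o1);
  R21 <- sub_prog C GD;
  o2 <- pluq R12;
  o3 <- pluq R21;
  GB <- mul G B;
  R22 <- sub_prog (drsubmx A) GB;
  SR <- mul (pluq_lower o3).2 R22;
  T <- mul SR (pluq_upper o2).2;
  P2 <- pinv_prog (pluq_mid o2);
  X <- mul T P2;
  XD <- mul X (pluq_mid o2);
  T1 <- sub_prog T XD;
  P3 <- pinv_prog (pluq_mid o3);
  Y <- mul P3 T1;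
  DY <- mul (pluq_mid o3) Y;
  T' <- sub_prog T1 DY;
  o4 <- pluq T';
  zG <- lower_pair G;
  zX <- lower_pair X;
  zY <- upper_pair Y;
  zH <- upper_pair H;
  S1 <- mul_pair mul2 (diag_pair (pluq_lower o1) (id_pair n)) zG;
  S2 <- mul_pair mul2 S1 (diag_pair (pluq_lower o2) (pluq_lower o3));
  S3 <- mul_pair mul2 S2 zX;
  S4 <- mul_pair mul2 S3 (diag_pair (id_pair n) (pluq_lower o4));
  U1 <- mul_pair mul2 (diag_pair (id_pair n) (pluq_upper o4)) zY;
  U2 <- mul_pair mul2 U1 (diag_pair (pluq_upper o3) (pluq_upper o2));
  U3 <- mul_pair mul2 U2 zH;
  U4 <- mul_pair mul2 U3 (diag_pair (pluq_upper o1) (id_pair n));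
  ret (PluqResult
    (block_pairs (pluq_pairs o1) (pluq_pairs o2) (pluq_pairs o3) (pluq_pairs o4))
    S4 (block_mx (pluq_mid o1) (pluq_mid o2) (pluq_mid o3) (pluq_mid o4)) U4).

(** Besides the recursive calls there are 13 products of size n, 16 of size n + n and 12 entrywise
    passes, each within the budget [u]; 50 is a round bound for these 41. *)
Lemma does_pluq_step : pluq_spec (4 * f + 50 * u) pluq_step_prog.
Proof.
move=> env s A R /denotes_submx[a11 a12 a21 a22].
(* The budget becomes an unknown that the steps fill in as a sum, to be compared with the claimed
   bound at the very end. *)
rewrite -[R]submxK; apply: does_le.
apply: does_bind; first exact: hpluq a11.
move=> s1 o1 + [S1 [S1' [D1 [U1 [U1' [dS1 dD1 dU1 h1]]]]]]; advance.
have [_ dS1' eS1] := dS1; have [_ dU1' eU1] := dU1.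
bind_step hmul => B dB.
bind_step hmul => C dC.
bind_step does_pinv => P1 dP1.
bind_step hmul => H dH.
bind_step hmul => G dG.
bind_step hmul => DH dDH.
bind_step does_sub => R12 dR12.
bind_step hmul => GD dGD.
bind_step does_sub => R21 dR21.
apply: does_bind; first exact: hpluq dR12.
move=> s2 o2 + [S2 [S2' [D2 [U2 [U2' [dS2 dD2 dU2 h2]]]]]]; advance.
have [_ dS2' eS2] := dS2; have [_ dU2' eU2] := dU2.
apply: does_bind; first exact: hpluq dR21.
move=> s3 o3 + [S3 [S3' [D3 [U3 [U3' [dS3 dD3 dU3 h3]]]]]]; advance.
have [_ dS3' eS3] := dS3; have [_ dU3' eU3] := dU3.
bind_step hmul => GB dGB.
bind_step does_sub => R22 dR22.
bind_step hmul => SR dSR.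
bind_step hmul => T dT.
bind_step does_pinv => P2 dP2.
bind_step hmul => X dX.
bind_step hmul => XD dXD.
bind_step does_sub => T1 dT1.
bind_step does_pinv => P3 dP3.
bind_step hmul => Y dY.
bind_step hmul => DY dDY.
bind_step does_sub => T' dT'.
apply: does_bind; first exact: hpluq dT'.
move=> s4 o4 + [S4 [S4' [D4 [U4 [U4' [dS4 dD4 dU4 h4]]]]]]; advance.
bind_step does_lower_pair => zG [G' pG].
bind_step does_lower_pair => zX [X' pX].
bind_step does_upper_pair => zY [Y' pY].
bind_step does_upper_pair => zH [H' pH].
pair_step => zS1 dzS1.
pair_step => zS2 dzS2.
pair_step => zS3 dzS3.
pair_step => zS4 dzS4.
pair_step => zU1 dzU1.
pair_step => zU2 dzU2.
pair_step => zU3 dzU3.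
pair_step => zU4 dzU4.
apply: does_ret; do 5!eexists; split.
- exact: dzS4.
- by apply: denotes_block; eassumption.
- exact: dzU4.
have [_ _ eS] := dzS4; have [_ _ eU] := dzU4.
exact: pluq_step h1 h2 h3 h4 _ _ eS eU.
lia.
Qed.

Definition ldl_step_prog (A : 'M[op]_(n + n)) : prog (ldl_result (n + n)) :=
  o1 <- ldl (ulsubmx A);
  B <- mul (ldl_lower o1).2 (ursubmx A);
  P1 <- pinv_prog (ldl_mid o1);
  H <- mul P1 B;
  BH <- conj_trmx_prog B;
  G <- mul BH P1;
  DH <- mul (ldl_mid o1) H;
  R <- sub_prog B DH;
  o2 <- pluq R;
  GB <- mul G B;
  C <- sub_prog (drsubmx A) GB;
  UH <- conj_trmx_prog (pluq_upper o2).1;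
  UH' <- conj_trmx_prog (pluq_upper o2).2;
  V <- mul UH' C;
  W <- mul V (pluq_upper o2).2;
  let cs := unzip2 (pluq_pairs o2) in
  let Y := mask_op (fun i j => before cs j i) W in
  let E := mask_op (fun i j => (i == j) && (i \in cs)) W in
  let W' := mask_op (fun i j => (i \notin cs) && (j \notin cs)) W in
  P2 <- pinv_prog (pluq_mid o2);
  X <- mul Y P2;
  o3 <- ldl W';
  PE <- pinv_prog E;
  Z <- mul (pluq_mid o2) PE;
  z <- zeros_prog E;
  DlH <- conj_trmx_prog (pluq_mid o2);
  ZD <- mul Z DlH;
  D11 <- sub_prog (ldl_mid o1) ZD;
  ZE <- mul Z E;
  D12 <- sub_prog (pluq_mid o2) ZE;
  D21 <- conj_trmx_prog D12;
  D22 <- add_prog E (ldl_mid o3);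
  zG <- lower_pair G;
  zX <- lower_pair X;
  zZ <- upper_pair Z;
  L1 <- mul_pair mul2 (diag_pair (ldl_lower o1) (id_pair n)) zG;
  L2 <- mul_pair mul2 L1 (diag_pair (pluq_lower o2) (UH, UH'));
  L3 <- mul_pair mul2 L2 zX;
  L4 <- mul_pair mul2 L3 (diag_pair (id_pair n) (ldl_lower o3));
  L5 <- mul_pair mul2 L4 zZ;
  ret (LdlResult
    (ldl_blocks (ldl_blks o1) (ldl_blks o3) (pluq_pairs o2) (fun c => z (c, c)))
    L5 (block_mx D11 D12 D21 D22)).

(** Here 11 products of size n, 10 of size n + n and 16 entrywise passes make 37 terms of at most
    [u]; the zero tests are free. *)
Lemma does_ldl_step : ldl_spec (2 * g + f + 50 * u) ldl_step_prog.
Proof.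
move=> env s A R /denotes_submx[a11 a12 a21 a22].
rewrite -[R]submxK conj_trmx_block => /eq_block_mx[hR11 _ <- hR22]; apply: does_le.
apply: does_bind; first exact: hldl a11 hR11.
move=> s1 o1 + [L1 [K1 [D1 [dL1 dD1 h1]]]]; advance.
have [_ dK1 eL1] := dL1.
bind_step hmul => B dB.
bind_step does_pinv => P1 dP1.
bind_step hmul => H dH.
bind_step does_conj_trmx => BH dBH.
bind_step hmul => G dG.
bind_step hmul => DH dDH.
bind_step does_sub => R12 dR12.
apply: does_bind; first exact: hpluq dR12.
move=> s2 o2 + [S [S' [Dl [U [U' [dS dDl dU h2]]]]]]; advance.
have [dU1 dU' eU] := dU.
bind_step hmul => GB dGB.
bind_step does_sub => C dC.
bind_step does_conj_trmx => UH dUH.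
bind_step does_conj_trmx => UH' dUH'.
have dUHp := denotes_pair_conj dUH dUH' eU.
bind_step hmul => V dV.
bind_step hmul => W dW.
set cs := unzip2 (pluq_pairs o2).
have dY := denotes_mask (fun i j => before cs j i) dW.
have dE := denotes_mask (fun i j => (i == j) && (i \in cs)) dW.
have dW' := denotes_mask (fun i j => (i \notin cs) && (j \notin cs)) dW.
bind_step does_pinv => P2 dP2.
bind_step hmul => X dX.
apply: does_bind.
  by apply: hldl dW' _; exact: (ldl_step_herm conjK hR11 hR22 erefl erefl erefl h1).
move=> s3 o3 + [L3 [K3 [D3 [dL3 dD3 h3]]]]; advance.
bind_step does_pinv => PE dPE.
bind_step hmul => Z dZ.
apply: does_bind; first exact: does_zeros dE.
move=> s4 z + hz; advance.
bind_step does_conj_trmx => DlH dDlH.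
bind_step hmul => ZD dZD.
bind_step does_sub => D11 dD11.
bind_step hmul => ZE dZE.
bind_step does_sub => D12 dD12.
bind_step does_conj_trmx => D21 dD21.
bind_step does_add => D22 dD22.
bind_step does_lower_pair => zG [G' pG].
bind_step does_lower_pair => zX [X' pX].
bind_step does_upper_pair => zZ [Z' pZ].
pair_step => zL1 dzL1.
pair_step => zL2 dzL2.
pair_step => zL3 dzL3.
pair_step => zL4 dzL4.
pair_step => zL5 dzL5.
apply: does_ret; do 3!eexists; split.
- exact: dzL5.
- by apply: denotes_block; eassumption.
have [_ _ eL] := dzL5.
exact: (ldl_step conjK hR11 hR22 erefl erefl erefl erefl erefl erefl erefl
  erefl erefl h1 h2 h3 (fun c _ => hz c c) eL).
lia.
Qed.

End Step.
End Algorithms.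

(** * The recursion and the final permutation *)

Section Recursion.
Variables (F : fieldType) (conj : {rmorphism F -> F}) (I : Type).
Hypothesis conjK : involutive conj.
Variable tm : nat -> nat.
Hypothesis hmul : forall n, exists mul, @mul_spec F conj I n (tm n) mul.

(* 2 ^ k, computing so that block matrices of size sz k.+1 need no casts *)
Fixpoint sz k : nat := if k is k'.+1 then sz k' + sz k' else 1.

(** A common budget for a product of either size and for an entrywise pass; the sum spares any
    monotonicity of [tm]. *)
Definition step_cost k := (tm (sz k) + tm (sz k.+1) + sz k * sz k)%N.

Fixpoint pluq_cost k : nat :=
  if k is k'.+1 then 4 * pluq_cost k' + 50 * step_cost k' else 0.

Fixpoint ldl_cost k : nat :=
  if k is k'.+1 then 2 * ldl_cost k' + pluq_cost k' + 50 * step_cost k' else 0.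

Lemma mul_spec_le n b b' mul :
  @mul_spec F conj I n b mul -> (b <= b')%N -> @mul_spec F conj I n b' mul.
Proof. by move=> h bb' env s A B X Y dA dB; exact: does_le (h _ _ _ _ _ _ dA dB) bb'. Qed.

Lemma pluq_exists k : exists p, @pluq_spec F conj I (sz k) (pluq_cost k) p.
Proof.
elim: k => [|k [pluq hpluq]] /=.
  exists (fun A : 'M[operand F I]_1 =>
    ifzero (A 0 0) (ret (PluqResult [::] (id_pair F I 1) A (id_pair F I 1)))
      (ret (PluqResult [:: (0, 0)] (id_pair F I 1) A (id_pair F I 1)))).
  move=> env s A R dA; have h := is_pluq_11 R.
  apply: does_ifzero; rewrite (denotes_read _ _ dA (prefix_refl _)) => R0;
    rewrite ?R0 ?eqxx ?(negbTE R0) in h; apply: does_ret; exists 1%:M, 1%:M, R, 1%:M, 1%:M;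
    by split=> //; exact: denotes_id_pair.
have [mul hm] := hmul (sz k); have [mul2 hm2] := hmul (sz k.+1).
exists (pluq_step_prog mul mul2 pluq).
apply: does_pluq_step => //; [apply: mul_spec_le hm _ | apply: mul_spec_le hm2 _ | ];
  rewrite /step_cost /=; lia.
Qed.

Lemma ldl_exists k : exists p, @ldl_spec F conj I (sz k) (ldl_cost k) p.
Proof.
elim: k => [|k [ldl hldl]] /=.
  exists (fun A : 'M[operand F I]_1 =>
    ifzero (A 0 0) (ret (LdlResult [::] (id_pair F I 1) A))
      (ret (LdlResult [:: [:: 0]] (id_pair F I 1) A))).
  move=> env s A R dA _; have h := is_ldl_11 conj R.
  apply: does_ifzero; rewrite (denotes_read _ _ dA (prefix_refl _)) => R0;
    rewrite ?R0 ?eqxx ?(negbTE R0) in h; apply: does_ret; exists 1%:M, 1%:M, R;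
    by split=> //; exact: denotes_id_pair.
have [mul hm] := hmul (sz k); have [mul2 hm2] := hmul (sz k.+1).
have [pluq hpluq] := pluq_exists k.
exists (ldl_step_prog mul mul2 pluq ldl).
apply: does_ldl_step => //; [apply: mul_spec_le hm _ | apply: mul_spec_le hm2 _ | ];
  rewrite /step_cost /=; lia.
Qed.

End Recursion.

Section Restriction.
Variables (F : fieldType) (conj : {rmorphism F -> F}).
Hypothesis conjK : involutive conj.
Local Notation "X ^H" := (conj_trmx conj X) (at level 8, format "X ^H").

(** * Removing the zero padding *)

Section Unpad.
Variables n m : nat.

Definition unlshift (x : 'I_(n + m)) : option 'I_n :=
  if fintype.split x is inl i then Some i else None.

Definition unpad_blocks (bl : seq (seq 'I_(n + m))) := map (pmap unlshift) bl.

Lemma unpad_blocksK (bl : seq (seq 'I_(n + m))) :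
  (forall i : 'I_m, rshift n i \notin flatten bl) ->
  map (map (lshift m)) (unpad_blocks bl) = bl.
Proof.
move=> H; rewrite /unpad_blocks -map_comp -[RHS]map_id; apply/eq_in_map => b bbl /=.
have {}H i : rshift n i \notin b.
  by apply: contra (H i) => ib; apply/flattenP; exists b.
elim: b H {bbl} => //= x b IH H; rewrite /unlshift.
case: (split_ordP x) => [i ei|i ei]; last by have := H i; rewrite ei mem_head.
rewrite /= -ei IH // => j; apply: contra (H j) => jb; by rewrite inE jb orbT.
Qed.

(** The padding rows are zero, so they hold no pivot and [L] is trivial in them. Its upper right
    block vanishes as well, since a non-pivot precedes nothing. Hence [L] and [D] are block diagonal
    and the factorization restricts. *)
Lemma is_ldl_unpad (A : 'M[F]_n) bl (L K D : 'M[F]_(n + m)) :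
  A^H = A -> is_ldl conj (block_mx A 0 0 (0 : 'M[F]_m)) bl L K D ->
  is_ldl conj A (unpad_blocks bl) (ulsubmx L) (ulsubmx K) (ulsubmx D).
Proof.
move=> hA h.
have row0 (i : 'I_m) : rshift n i \notin flatten bl /\
    forall k, L (rshift n i) k = (rshift n i == k)%:R.
  apply: is_ldl_row0 h _ => j; rewrite -[j]fintype.splitK.
  by case: (fintype.split j) => {}j /=; rewrite (block_mxEdl, block_mxEdr) mxE.
have eb := unpad_blocksK (fun i => (row0 i).1).
have lI := @lshift_inj n m.
have [hs tL KL mD eA] := h.
have efl : flatten bl = map (lshift m) (flatten (unpad_blocks bl)).
  by rewrite -{1}eb map_flatten.
have een : block_entries bl =
    map_pairs (lshift m) (lshift m) (block_entries (unpad_blocks bl)).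
  by rewrite -{1}eb block_entries_map.
have eL : L = block_mx (ulsubmx L) 0 0 1%:M.
  rewrite -[LHS]submxK; congr block_mx; apply/matrixP => i j; rewrite !mxE.
  - rewrite tL ?eq_lrshift //; apply: contra (row0 j).1 => /before_in; exact.
  - by rewrite (row0 i).2 eq_rlshift.
  - by rewrite (row0 i).2 (inj_eq (@rshift_inj _ _)).
have eD : D = block_mx (ulsubmx D) 0 0 0.
  rewrite -[LHS]submxK; congr block_mx; apply/matrixP => i j; rewrite !mxE.
  - rewrite (monomial_col0 mD) // (perm_mem (perm_unzip2_block_entries _)).
    exact: (row0 _).1.
  - by rewrite (monomial_row0 mD) // unzip1_block_entries; exact: (row0 _).1.
  - by rewrite (monomial_row0 mD) // unzip1_block_entries; exact: (row0 _).1.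
split.
- by move=> b bb; rewrite -(size_map (lshift m)); apply: hs; rewrite -eb; exact: map_f.
- move=> i j b; rewrite !mxE tL ?(inj_eq lI) //.
  by rewrite efl before_map.
- move: KL; rewrite eL -{1}[K]submxK mulmx_block !(mulmx0, addr0, mulmx1, add0r).
  by rewrite block_mxKul scalar_mx_block => /eq_block_mx[].
- case: mD => u1 u2 hD; split.
  + by rewrite -(map_inj_uniq lI) -(unzip1_map_pairs _ (lshift m)) -een.
  + by rewrite -(map_inj_uniq lI) -(unzip2_map_pairs (lshift m)) -een.
  + by move=> i j; rewrite !mxE hD een mem_map_pairs.
- move: eA; rewrite eL eD !block_mxKul conj_trmx_block !mulmx_block.
  by rewrite !conj_trmx0 !(mulmx0, mul0mx, addr0, add0r) => /eq_block_mx[].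
Qed.

End Unpad.

Lemma reshape_index_flatten (T : eqType) (x0 : T) (ss : seq (seq T)) i k :
  uniq (flatten ss) -> (i < size (flatten ss))%N -> (k < size ss)%N ->
  nth x0 (flatten ss) i \in nth [::] ss k -> reshape_index (shape ss) i = k.
Proof.
move=> u isz ksz ik; set c := index (nth x0 (flatten ss) i) (nth [::] ss k).
have csz : (c < nth 0 (shape ss) k)%N by rewrite (nth_map [::]) // index_mem.
suff -> : i = flatten_index (shape ss) k c by rewrite flatten_indexKl.
apply/eqP; rewrite -(nth_uniq x0 isz _ u) ?size_flatten ?flatten_indexP //.
by rewrite [eqbRHS]nth_flatten flatten_indexKl // flatten_indexKr // nth_index.
Qed.

Lemma mem_zip (T U : eqType) (s : seq T) (t : seq U) x y :
  (x, y) \in zip s t -> (x \in s) && (y \in t).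
Proof.
elim: s t => [|a s IH] [|b t] //=; rewrite !inE xpair_eqE.
by case/orP => [/andP[-> ->]|/IH/andP[-> ->]]; rewrite ?orbT.
Qed.

(** * Moving the pivots to the front *)

Section Permute.
Variable n : nat.
Implicit Types (s : 'S_n) (A : 'M[F]_n) (bl : seq (seq 'I_n)).

(** For any [T], because it also rearranges matrices of operands, at no arithmetic cost. *)
Definition sym_perm T (s : 'S_n) (A : 'M[T]_n) : 'M[T]_n := \matrix_(i, j) A (s i) (s j).

Lemma sym_perm_mul s A B : sym_perm s (A *m B) = sym_perm s A *m sym_perm s B.
Proof.
apply/matrixP => i j; rewrite !mxE (reindex_inj (@perm_inj _ s)).
by apply: eq_bigr => k _; rewrite !mxE.
Qed.

Lemma sym_permE s A :
  (perm_mx s^-1)^T *m A *m perm_mx s^-1 = sym_perm s A.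
Proof.
rewrite tr_perm_mx invgK -row_permE -col_permE.
by apply/matrixP => i j; rewrite !mxE.
Qed.

(** Non-pivots are appended as singletons: the block sizes then add up to [n], and the zero rows and
    columns of [D] come last. *)
Definition all_blocks bl : seq (seq 'I_n) :=
  bl ++ [seq [:: x] | x <- enum 'I_n & x \notin flatten bl].

Lemma flatten_all_blocks bl :
  flatten (all_blocks bl) = flatten bl ++ [seq x <- enum 'I_n | x \notin flatten bl].
Proof. by rewrite flatten_cat flatten_seq1. Qed.

Lemma perm_all_blocks bl :
  uniq (flatten bl) -> perm_eq (flatten (all_blocks bl)) (enum 'I_n).
Proof.
move=> u; rewrite flatten_all_blocks; apply: uniq_perm; last 2 first.
- exact: enum_uniq.
- by move=> x; rewrite mem_cat mem_filter mem_enum andbT orbN.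
rewrite cat_uniq u filter_uniq ?enum_uniq // andbT.
by apply/hasPn => x; rewrite mem_filter => /andP[].
Qed.

(** With [pick] the permutation is defined for every [bl], so a program can output it without
    carrying a proof that the indices are distinct. *)
Definition blocks_perm bl : 'S_n :=
  odflt 1%g [pick s : 'S_n | [forall i, s i == nth i (flatten (all_blocks bl)) i]].

Lemma blocks_permE bl i :
  uniq (flatten bl) -> blocks_perm bl i = nth i (flatten (all_blocks bl)) i.
Proof.
move=> u; have p := perm_all_blocks u.
have sz : size (flatten (all_blocks bl)) = n by rewrite (perm_size p) size_enum_ord.
have u' : uniq (flatten (all_blocks bl)) by rewrite (perm_uniq p) enum_uniq.
rewrite /blocks_perm; case: pickP => [s /forallP/(_ i)/eqP //|H].
pose f (j : 'I_n) := nth j (flatten (all_blocks bl)) j.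
have finj : injective f.
  move=> j k; rewrite /f (set_nth_default k) ?sz // => /eqP.
  by rewrite nth_uniq ?sz // => /eqP; exact: val_inj.
by have /forallP[] := H (perm finj) => j; rewrite permE.
Qed.

Section Final.
Variables (A : 'M[F]_n) (bl : seq (seq 'I_n)) (L K D : 'M[F]_n).
Hypotheses (hA : A^H = A) (h : is_ldl conj A bl L K D).
Local Notation s := (blocks_perm bl).
Local Notation fl := (flatten bl).

Let u : uniq fl.
Proof. by case: h => _ _ _ [+ _ _] _; rewrite unzip1_block_entries. Qed.

Let sizes : size (flatten (all_blocks bl)) = n.
Proof. by rewrite (perm_size (perm_all_blocks u)) size_enum_ord. Qed.

Let u_all : uniq (flatten (all_blocks bl)).
Proof. by rewrite (perm_uniq (perm_all_blocks u)) enum_uniq. Qed.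

Let mem_s i : (s i \in fl) = (i < size fl)%N.
Proof.
rewrite blocks_permE // flatten_all_blocks nth_cat; case: ltnP => isz.
  by rewrite mem_nth.
apply/negbTE; set t := [seq _ <- _ | _]; set k := (i - _)%N.
suff : nth i t k \in t by rewrite mem_filter => /andP[].
apply: mem_nth; rewrite /k ltn_subLR // -size_cat.
by rewrite -flatten_all_blocks sizes.
Qed.

Let index_s (i : 'I_n) : (i < size fl)%N -> index (s i) fl = i.
Proof.
move=> isz; rewrite blocks_permE // flatten_all_blocks nth_cat isz.
by rewrite index_uniq.
Qed.

(** [L] and its conjugate transpose are invertible, and [D] and the projection onto the pivots are
    multiples of each other, so the rank is that of the projection; sorting by [s] turns it into
    [pid_mx]. *)
Lemma rank_ldl : \rank A = size fl.
Proof.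
have [_ _ KL mD eA] := h.
have uL : L \in unitmx by case: (mulmx1_unit KL).
have uLH : L^H \in unitmx.
  have : K^H *m L^H = 1%:M *m 1%:M.
    by rewrite -conj_trmx_mul (mulmx1C KL) conj_trmx1 mul1mx.
  by rewrite mul1mx => /mulmx1_unit[].
have -> : \rank A = \rank D.
  rewrite eA mxrankMfree ?row_free_unit //.
  by rewrite (eqmxMfull _ _) ?row_full_unit.
have -> : \rank D = \rank (pivot_proj F fl).
  apply/eqP; rewrite eqn_leq -[fl]unzip1_block_entries; apply/andP; split.
    by rewrite -{1}(mul_pivot_projl mD) mxrankM_maxl.
  by rewrite -(mul_pinv mD) mxrankM_maxl.
have e : perm_mx s *m pivot_proj F fl *m perm_mx s^-1 = pid_mx (size fl).
  have := sym_permE s (pivot_proj F fl); rewrite tr_perm_mx invgK => ->.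
  apply/matrixP => i j.
  by rewrite !mxE (inj_eq perm_inj) mem_s.
have <- : \rank (perm_mx s *m pivot_proj F fl *m perm_mx s^-1) = \rank (pivot_proj F fl).
  rewrite mxrankMfree ?row_free_unit ?unitmx_perm //.
  by rewrite (eqmxMfull _ _) ?row_full_unit ?unitmx_perm.
rewrite e rank_pid_mx //; have := sizes; rewrite flatten_all_blocks size_cat; lia.
Qed.

Lemma is_LDL_sym_perm :
  is_LDL conj A (perm_mx s^-1) (sym_perm s L) (sym_perm s D).
Proof.
have [hsz tL KL mD eA] := h; have [_ _ nzD] := mD.
have blk x y : D x y != 0 -> exists2 b, b \in bl & (x, y) \in zip b (rev b).
  by rewrite nzD => /flatten_mapP.
have idx b (i : 'I_n) : b \in bl -> s i \in b ->
    reshape_index (shape (all_blocks bl)) i = index b bl.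
  move=> bb sib; apply: (@reshape_index_flatten _ i); rewrite ?sizes //.
    by rewrite size_cat ltn_addr // index_mem.
  by rewrite nth_cat index_mem bb nth_index // -blocks_permE.
split.
- exact: perm_mx_is_perm.
- split; last by move=> i; rewrite mxE (unitri_diag _ tL).
  apply/is_trig_mxP => i j ij; rewrite mxE tL.
    by rewrite (inj_eq perm_inj) -val_eqE /= (ltn_eqF ij).
  (* After the permutation, the rank of a pivot in the elimination order is its position, so a later
     index cannot precede an earlier one. *)
  apply/negP => b; move: (b); rewrite /before.
  have jsz : (j < size fl)%N by rewrite -mem_s (before_in b).
  by rewrite !index_s // ?(ltn_trans ij) // ltnNge (ltnW ij).
- split.
    rewrite -[in RHS](is_ldl_herm conjK hA h); apply/matrixP => i j; by rewrite !mxE.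
  exists (shape (all_blocks bl)); split.
  + by rewrite -size_flatten sizes.
  + move=> k; rewrite /shape map_cat mem_cat => /orP[/mapP[b bb ->]|/mapP[b /mapP[x _ ->] ->]].
      exact: hsz.
    by left.
  + move=> i j; rewrite mxE; have [//|/blk[b bb xy] []] := eqVneq (D (s i) (s j)) 0.
    have /andP[xb yb] : (s i \in b) && (s j \in b).
      by have := mem_zip xy; rewrite mem_rev.
    by rewrite (idx b) // (idx b).
  + move=> i; rewrite mxE; have [//|/blk[b bb xx]] := eqVneq (D (s i) (s i)) 0.
    have xb : s i \in b by have := mem_zip xx => /andP[].
    rewrite (idx b) // (nth_map [::]); last by rewrite size_cat ltn_addr // index_mem.
    rewrite nth_cat index_mem bb nth_index //.
    have ub : uniq b.
      by move: u; rewrite (perm_uniq (perm_flatten (perm_to_rem bb))) /= cat_uniq => /and3P[].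
    (* A block of two distinct indices only carries the entries (a, c) and (c, a), never a diagonal
       one. *)
    case: b ub xx {bb xb} => [|a [|c [|? ?]]] //= /andP[ac _].
    rewrite !inE !xpair_eqE => /orP[]/andP[/eqP-> /eqP e]; move: ac;
      by rewrite inE e eqxx.
- move=> i j; rewrite rank_ldl mxE => /orP[]; rewrite leqNgt -mem_s => ns.
    by rewrite (monomial_row0 mD) // unzip1_block_entries.
  by rewrite (monomial_col0 mD) // (perm_mem (perm_unzip2_block_entries _)).
- rewrite sym_permE eA !sym_perm_mul; congr (_ *m _).
  by apply/matrixP => i j; rewrite !mxE.
Qed.

End Final.
End Permute.
End Restriction.

(** * The algorithm and its cost *)

Section Assembly.
Variables (F : fieldType) (conj : {rmorphism F -> F}).
Hypothesis conjK : involutive conj.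

Lemma mul_spec_of_tree I n (b : nat)
    (t : ctree F (('I_n * 'I_n) + ('I_n * 'I_n))
           'M[operand F (('I_n * 'I_n) + ('I_n * 'I_n))]_n) :
  (forall X Y : 'M[F]_n, exists c s Z,
    [/\ runs conj (entries2 X Y) t [::] c s Z, (c <= b)%N &
        map_mx (read (entries2 X Y) s) Z = X *m Y]) ->
  exists mul, @mul_spec F conj I n b mul.
Proof.
move=> ht; exists (fun A B => relocate (fun k => match k with
  inl ij => A ij.1 ij.2 | inr ij => B ij.1 ij.2 end) t).
move=> env s A B X Y dA dB; have [c [s' [Z [rt cb <-]]]] := ht X Y.
apply: does_relocate rt cb => -[ij|ij] s'' ss'' /=.
  exact: denotes_read dA ss''.
exact: denotes_read dB ss''.
Qed.

(** The zero tests determine the pivots at every leaf, so the permutation and the rank are part of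
    the leaf and need no further operation. *)
Definition ldl_tree n m (p : 'M[operand F ('I_n * 'I_n)]_(n + m) ->
    prog F ('I_n * 'I_n) (ldl_result F ('I_n * 'I_n) (n + m))) :
    ctree F ('I_n * 'I_n) (ldl_output F n) :=
  bind (p (block_mx (\matrix_(i, j) Input F (i, j)) (map_mx (Const _) 0)
            (map_mx (Const _) 0) (map_mx (Const _) 0)))
    (fun o => let bl := unpad_blocks (ldl_blks o) in
      ret (LdlOutput (blocks_perm bl)^-1%g
        (sym_perm (blocks_perm bl) (ulsubmx (ldl_lower o).1))
        (sym_perm (blocks_perm bl) (ulsubmx (ldl_mid o)))
        (size (flatten bl)))) 0.

Lemma ldl_tree_spec n N b (p : 'M[operand F ('I_n * 'I_n)]_N ->
    prog F ('I_n * 'I_n) (ldl_result F ('I_n * 'I_n) N)) :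
  (n <= N)%N -> ldl_spec conj b p ->
  exists t : ctree F ('I_n * 'I_n) (ldl_output F n),
    forall A : 'M[F]_n, conj_trmx conj A = A -> exists c s out,
      [/\ runs conj (entries A) t [::] c s out, (c <= b)%N,
          is_LDL conj A (perm_mx (ldl_perm out))
            (map_mx (read (entries A) s) (ldl_L out))
            (map_mx (read (entries A) s) (ldl_D out)) &
          ldl_rank out = \rank A].
Proof.
move=> nN; move: p; rewrite -(subnKC nN); move: (N - n)%N => m p hp.
exists (ldl_tree p) => A hA.
have h0 : conj_trmx conj (block_mx A 0 0 (0 : 'M[F]_m)) = block_mx A 0 0 0.
  by rewrite conj_trmx_block !conj_trmx0 hA.
have dA : denotes (entries A) [::] (block_mx (\matrix_(i, j) Input F (i, j))
    (map_mx (Const _) 0) (map_mx (Const _) 0) (map_mx (Const _) 0))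
    (block_mx A 0 0 (0 : 'M[F]_m)).
  apply: denotes_block; try exact: denotes_const.
  by apply: denotesP => s i j _; rewrite mxE.
pose f (o : ldl_result F ('I_n * 'I_n) (n + m)) :=
  let bl := unpad_blocks (ldl_blks o) in
  LdlOutput (blocks_perm bl)^-1%g
        (sym_perm (blocks_perm bl) (ulsubmx (ldl_lower o).1))
        (sym_perm (blocks_perm bl) (ulsubmx (ldl_mid o)))
        (size (flatten bl)).
have [c [s [out [ro cb _ [L [K [D [[dL _ KL] dD h]]]]]]]] := hp _ _ _ _ dA h0.
have {}h := is_ldl_unpad hA h.
exists (c + 0)%N, s, (f out); split.
- by apply: (runs_bind ro (f := fun o => ret (f o))).
- by rewrite addn0.
- rewrite (_ : map_mx _ (ldl_L (f out)) = sym_perm (blocks_perm (unpad_blocks (ldl_blks out))) (ulsubmx L)).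
    rewrite (_ : map_mx _ (ldl_D (f out)) = sym_perm (blocks_perm (unpad_blocks (ldl_blks out))) (ulsubmx D)).
      exact: is_LDL_sym_perm h.
    by apply/matrixP => i j; rewrite !mxE (denotes_read _ _ dD (prefix_refl _)).
  by apply/matrixP => i j; rewrite !mxE (denotes_read _ _ dL (prefix_refl _)).
- by rewrite (rank_ldl h).
Qed.

End Assembly.

(** * Solving the cost recurrences *)

Section Cost.
Variables (R : realType).

(** The constant c = C / (q - a) solves a c + C = q c, so the induction step closes with
    equality. *)
Lemma geometric_bound (f : nat -> nat) (a q C : R) :
  0 <= a -> a < q -> f 0%N = 0%N ->
  (forall k, (f k.+1)%:R <= a * (f k)%:R + C * q ^+ k) -> 0 <= C ->
  forall k, (f k)%:R <= C / (q - a) * q ^+ k.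
Proof.
move=> a0 aq f0 hf C0; have qa : 0 < q - a by rewrite subr_gt0.
elim=> [|k IH]; first by rewrite f0 expr0 mulr1 divr_ge0 // ltW.
apply: le_trans (hf k) _; apply: le_trans (_ : a * (C / (q - a) * q ^+ k) + C * q ^+ k <= _).
  by rewrite lerD2r ler_wpM2l.
have {2}-> : C = C / (q - a) * (q - a) by rewrite divfK // gt_eqF.
rewrite exprS le_eqVlt; apply/orP; left; apply/eqP; ring.
Qed.

Lemma szE k : sz k = (2 ^ k)%N.
Proof. by elim: k => //= k ->; rewrite expnS mul2n addnn. Qed.

Lemma sz_powR k (omega : R) : (sz k)%:R `^ omega = (2 `^ omega) ^+ k.
Proof.
rewrite szE natrX -powR_mulrn // powRAC powR_mulrn //; exact: powR_ge0.
Qed.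

Lemma two_powR_gt4 (omega : R) : 2 < omega -> 4 < 2 `^ omega.
Proof.
move=> h; have -> : omega = 2%:R + (omega - 2) by rewrite addrC subrK.
rewrite powRD ?pnatr_eq0 ?implybT // powR_mulrn // (_ : 4 = 2 ^+ 2 * 1); last by ring.
have w0 : 0 < omega - 2 by rewrite subr_gt0.
have := @gt0_ltr_powR R _ w0 1 2; rewrite powR1 ltr_pM2l ?exprn_gt0 //.
by apply; rewrite ?nnegrE // ltr1n.
Qed.

Lemma big_O_pow_bound (T : nat -> nat) (omega : R) : 0 <= omega ->
  big_O_pow T omega ->
  exists2 C : R, 0 <= C & forall n, (0 < n)%N -> (T n)%:R <= C * n%:R `^ omega.
Proof.
move=> w0 /eqO_exP[C C0 [N _ hN]].
(* The sum covers the finitely many sizes below the threshold, as n^omega is at least 1 for positive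
   n. *)
exists (C + (\sum_(i < N) T i)%:R); first by rewrite addr_ge0 // ltW.
move=> n n0; have n1 : 1 <= n%:R `^ omega :> R.
  by have := @ge0_ler_powR R _ w0 1 n%:R; rewrite powR1; apply; rewrite ?nnegrE // ler1n.
rewrite mulrDl; case: (leqP N n) => Nn.
  have := hN n Nn; rewrite /= !ger0_norm ?powR_ge0 // => /le_trans; apply.
  by rewrite lerDl mulr_ge0 // powR_ge0.
apply: le_trans (_ : (\sum_(i < N) T i)%:R <= _).
  by rewrite ler_nat (bigD1 (Ordinal Nn)) //= leq_addr.
apply: le_trans (_ : (\sum_(i < N) T i)%:R * n%:R `^ omega <= _).
  by rewrite ler_peMr.
by rewrite lerDr mulr_ge0 ?powR_ge0 // ltW.
Qed.

Lemma ldl_cost_bound (tm : nat -> nat) (omega : R) : 2 < omega -> big_O_pow tm omega ->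
  exists2 C : R, 0 <= C & forall k, (ldl_cost tm k)%:R <= C * (2 `^ omega) ^+ k.
Proof.
move=> w2 hO; have w0 : 0 <= omega by apply: ltW; apply: lt_trans w2.
have [C C0 hC] := big_O_pow_bound w0 hO.
set q := 2 `^ omega; have q4 : 4 < q by exact: two_powR_gt4.
have q0 : 0 <= q by apply: ltW; apply: lt_trans q4.
have htm k : (tm (sz k))%:R <= C * q ^+ k.
  by rewrite /q -sz_powR; apply: hC; rewrite szE expn_gt0.
(* One summand for each term of [step_cost]: doubling the size costs a factor q, and the entrywise
   passes cost 4^k, at most q^k. *)
pose C1 := C + C * q + 1.
have C10 : 0 <= C1 by rewrite !addr_ge0 // mulr_ge0.
have hstep k : (step_cost tm k)%:R <= C1 * q ^+ k.
  rewrite /step_cost !natrD /C1 !mulrDl mul1r; apply: lerD.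
    by apply: lerD => //; apply: le_trans (htm k.+1) _; rewrite exprS mulrA.
  rewrite szE -expnMn natrX; apply: lerXn2r; rewrite ?nnegrE //; exact: ltW.
have hp k : (pluq_cost tm k)%:R <= 50 * C1 / (q - 4) * q ^+ k.
  apply: (geometric_bound _ q4) => // [j|]; last by rewrite mulr_ge0.
  have -> : pluq_cost tm j.+1 = (4 * pluq_cost tm j + 50 * step_cost tm j)%N by [].
  by rewrite natrD (natrM _ 4) (natrM _ 50) lerD2l -mulrA ler_wpM2l.
have q2 : 2 < q by apply: lt_trans q4; rewrite ltr_nat.
pose C2 := 50 * C1 / (q - 4) + 50 * C1.
have C20 : 0 <= C2.
  by rewrite /C2 addr_ge0 ?mulr_ge0 ?invr_ge0 ?subr_ge0 // ltW.
exists (C2 / (q - 2)); first by rewrite divr_ge0 // subr_ge0 ltW.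
apply: (geometric_bound _ q2) => // j.
have -> : ldl_cost tm j.+1 =
    (2 * ldl_cost tm j + pluq_cost tm j + 50 * step_cost tm j)%N by [].
rewrite 2!natrD (natrM _ 2) (natrM _ 50) -addrA lerD2l /C2.
rewrite (mulrDl (50 * C1 / (q - 4))); apply: lerD; first exact: hp.
by rewrite -mulrA ler_wpM2l.
Qed.

Lemma up_log2_le n : (0 < n)%N -> (2 ^ up_log 2 n <= 2 * n)%N.
Proof.
case: n => [|[|n]] // _; have := @up_log_gtn 2 n.+2 isT isT.
have : (0 < up_log 2 n.+2)%N by rewrite up_log_gt0.
by case: (up_log 2 n.+2) => // k _ /= kn; rewrite expnS leq_mul2l ltnW.
Qed.

Lemma big_O_pow_ldl_cost (tm : nat -> nat) (omega : R) :
  2 < omega -> big_O_pow tm omega ->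
  big_O_pow (fun n => ldl_cost tm (up_log 2 n)) omega.
Proof.
move=> w2 hO; have w0 : 0 <= omega by apply: ltW; apply: lt_trans w2.
have [C C0 hC] := ldl_cost_bound w2 hO.
(* Padding to a power of two at most doubles the size, hence the factor 2^omega; adding 1 makes the
   constant positive. *)
apply/eqO_exP; exists (C * 2 `^ omega + 1).
  by rewrite ltr_wpDl // mulr_ge0 // powR_ge0.
exists 1%N => // n /= n1; rewrite !ger0_norm ?powR_ge0 //.
apply: le_trans (hC _) _; rewrite -sz_powR mulrDl mul1r.
apply: ler_wpDr; first exact: powR_ge0.
rewrite -mulrA -powRM // ler_wpM2l //; apply: ge0_ler_powR; rewrite ?nnegrE //.
by rewrite -natrM ler_nat szE up_log2_le.
Qed.

End Cost.

Theorem theorem4p2 (F : fieldType) (conj : {rmorphism F -> F})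
    (conjK : involutive conj) (R : realType) (omega : R)
    (homega : 2 < omega) (hmm : matmul_exponent conj omega) :
  exists (alg : forall n : nat, ctree F ('I_n * 'I_n) (ldl_output F n))
         (T : nat -> nat),
    ldl_algorithm conj alg T /\ big_O_pow T omega.
Proof.
have [mm [tm [hO hm]]] := hmm.
have H n : { t : ctree F ('I_n * 'I_n) (ldl_output F n) |
    forall A : 'M[F]_n, conj_trmx conj A = A -> exists c s out,
      [/\ runs conj (entries A) t [::] c s out, (c <= ldl_cost tm (up_log 2 n))%N,
          is_LDL conj A (perm_mx (ldl_perm out))
            (map_mx (read (entries A) s) (ldl_L out))
            (map_mx (read (entries A) s) (ldl_D out)) &
          ldl_rank out = \rank A] }.
  (* The model being non-uniform, it is enough that a tree exists for every size; [cid] chooses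
     one. *)
  apply: cid; have [p hp] : exists p, @ldl_spec F conj ('I_n * 'I_n)
      (sz (up_log 2 n)) (ldl_cost tm (up_log 2 n)) p.
    by apply: ldl_exists => // m; apply: mul_spec_of_tree (mm m) (hm m).
  by apply: ldl_tree_spec hp; rewrite // szE up_logP.
exists (fun n => projT1 (H n)), (fun n => ldl_cost tm (up_log 2 n)); split.
  by move=> n A; exact: (projT2 (H n)).
exact: big_O_pow_ldl_cost.
Qed.
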